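(* Let $N\ge 3$, $p>1$, $\mu\ge 0$, and let $K$ satisfy (K0) and $f$ satisfy (F0). Assume $p>p_S(\alpha)$. If equation $(E_\mu)$ has infinitely many bounded solutions $\{u_j\}_{j=0}^\infty$ with $\|u_j\|_{L^\infty}\to\infty$ as $j\to\infty$, then $(E_\mu)$ has a singular solution $u^*$ (defined and positive on all of $(0,\infty)$).
   Context: Throughout, $N\ge3$ and $p>1$. $K:(0,\infty)\to(0,\infty)$ is continuous and satisfies (K0): $K(r)=(k_0+o(1))r^{\alpha}$ as $r\to0$ for some $\alpha>-2$ and $k_0>0$. $f:(0,\infty)\to[0,\infty)$ is continuous, not identically zero, and satisfies (F0): $f(r)=O(r^{\nu})$ as $r\to0$ for some $\nu>-2$. For $\mu\ge0$, equation $(E_\mu)$ is the radial problem $u''+\frac{N-1}{r}u'+K(r)u^p+\mu f(r)=0$ and $u>0$ for $r>0$. A bounded solution of $(E_\mu)$ is $u\in C^2(0,\infty)$ satisfying $(E_\mu)$ pointwise on $(0,\infty)$ such that $\lim_{r\to0}u(r)$ exists and is finite. A singular solution is $u\in C^2(0,\infty)$ satisfying $(E_\mu)$ pointwise on $(0,\infty)$ with $\lim_{r\to0}u(r)=\infty$. $p_S(\alpha):=\frac{N+2+2\alpha}{N-2}$. *)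

(* Defs.v *)
From Stdlib Require Import Reals.
From Coquelicot Require Import Coquelicot.
Open Scope R_scope.

Definition K0_hyp (K : R -> R) (alpha k0 : R) : Prop :=
  (forall r, 0 < r -> continuous K r) /\
  (forall r, 0 < r -> 0 < K r) /\
  alpha > -2 /\ k0 > 0 /\
  filterlim (fun r => K r / Rpower r alpha) (at_right 0) (locally k0).

Definition F0_hyp (f : R -> R) (nu : R) : Prop :=
  (forall r, 0 < r -> continuous f r) /\
  (forall r, 0 < r -> 0 <= f r) /\
  (exists r, 0 < r /\ f r <> 0) /\
  nu > -2 /\
  (exists C delta, 0 < delta /\
     forall r, 0 < r < delta -> Rabs (f r) <= C * Rpower r nu).

Definition solves_E (N : nat) (p mu : R) (K f : R -> R) (u : R -> R) : Prop :=
  exists u1 u2 : R -> R,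
    forall r, 0 < r ->
      is_derive u r (u1 r) /\ is_derive u1 r (u2 r) /\ continuous u2 r /\
      0 < u r /\
      u2 r + (INR N - 1) / r * u1 r + K r * Rpower (u r) p + mu * f r = 0.

Definition bounded_solution (N : nat) (p mu : R) (K f : R -> R) (u : R -> R) : Prop :=
  solves_E N p mu K f u /\
  exists l : R, filterlim u (at_right 0) (locally l).

Definition singular_solution (N : nat) (p mu : R) (K f : R -> R) (u : R -> R) : Prop :=
  solves_E N p mu K f u /\
  filterlim u (at_right 0) (Rbar_locally p_infty).

Definition p_S (N : nat) (alpha : R) : R := (INR N + 2 + 2 * alpha) / (INR N - 2).

(* Main.v *)
Require Import Defs.
From Stdlib Require Import Reals Lra Lia Ranalysis5 IndefiniteDescription.
From Coquelicot Require Import Coquelicot.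
Open Scope R_scope.

(** Put theta = (2 + alpha) / (p - 1) and W(r) = r^theta u(r).  Every solution satisfies
    u' <= 0 and r u' + (N - 2) u >= 0, and W <= C near the origin with C independent of u.
    In the variable ln r, W solves an asymptotically autonomous equation
    W'' + a W' - b W + k0 W^p = o(1), where p > p_S(alpha) is exactly the condition a > 0 of
    positive damping.  A bounded solution with u(0) = L is still comparable to L at
    r = d L^(-1/theta), and there a strict Lyapunov function of the autonomous equation takes
    a value below a fixed level - delta < 0.  On that level set the Lyapunov function strictly
    decreases as long as the o(1) terms are small, so it stays below - delta up to a radius r0
    independent of L, which forces W >= m > 0 on [d L^(-1/theta), r0].  Hence the u_j are
    bounded above and away from zero locally uniformly on (0, oo); by Bolzano-Weierstrass for
    the data at r0 and Gronwall's inequality a subsequence converges to a solution u* with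
    u* >= m r^(-theta) on (0, r0]. *)

(** * Real powers and monotonicity *)

(** The obstacle is that ln r0 - ln r1, with r1 = d L^(-1/theta), grows without bound with L, so the
    effect of the o(1) terms cannot simply be summed along the way. The plain energy loses only a
    Z^2, where Z = r W', hence nothing where Z = 0, and a perturbation could win there. The cross
    term of [lyap] adds a loss proportional to (force W)^2. The loss then vanishes only at the two
    rest points: the origin, at level 0, and the positive zero of the force, at a negative level. A
    level - delta strictly between these two stays away from both; on it the loss has a positive
    lower bound, and a small enough perturbation can never push the orbit back up, however long the
    passage lasts. A second difficulty is that a bounded solution is only known to have a limit at
    the origin, with no information on u' there. Integrations from 0 therefore start at a small s >
    0, and their boundary terms are removed by a sign, by a vanishing power of s, or by choosing s
    with small flux. *)

Lemma Rpower_pos (x a : R) : 0 < Rpower x a.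
Proof. apply exp_pos. Qed.

Lemma Rpower_base_1 (a : R) : Rpower 1 a = 1.
Proof. unfold Rpower. rewrite ln_1, Rmult_0_r. apply exp_0. Qed.

Lemma is_derive_Rpower_comp (u : R -> R) (a r du : R) :
  0 < u r -> is_derive u r du ->
  is_derive (fun x => Rpower (u x) a) r (a * Rpower (u r) a / u r * du).
Proof.
  intros Hu Hd. unfold Rpower.
  evar_last.
  { apply (is_derive_comp exp (fun x => a * ln (u x))).
    - apply is_derive_exp.
    - apply (is_derive_scal (fun x => ln (u x))).
      apply (is_derive_comp ln u); [apply is_derive_ln; exact Hu | exact Hd]. }
  unfold scal; simpl; unfold mult; simpl. field. lra.
Qed.

Lemma is_derive_Rpower (a r : R) :
  0 < r -> is_derive (fun x => Rpower x a) r (a * Rpower r a / r).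
Proof.
  intros Hr. evar_last.
  { apply (is_derive_Rpower_comp (fun x => x) a r 1 Hr). apply (is_derive_id (K := R_AbsRing)). }
  simpl. ring.
Qed.

Lemma Rpower_small (a eps : R) :
  0 < a -> 0 < eps -> exists d, 0 < d /\ forall r, 0 < r <= d -> Rpower r a <= eps.
Proof.
  intros Ha He. exists (Rpower eps (/ a)). split; [apply Rpower_pos|].
  intros r Hr.
  apply Rle_trans with (Rpower (Rpower eps (/ a)) a).
  - apply Rle_Rpower_l; lra.
  - rewrite Rpower_mult, Rinv_l, Rpower_1; lra.
Qed.

Lemma Rpower_div_self (x a : R) : 0 < x -> Rpower x (a - 1) = Rpower x a / x.
Proof.
  intros Hx. replace (a - 1) with (a + - (1)) by ring.
  rewrite Rpower_plus, Rpower_Ropp, Rpower_1; auto.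
Qed.

Lemma nondecreasing_of_derive (g dg : R -> R) (a b : R) :
  a <= b ->
  (forall x, a <= x <= b -> is_derive g x (dg x)) ->
  (forall x, a <= x <= b -> 0 <= dg x) -> g a <= g b.
Proof.
  intros Hab Hd Hp.
  destruct (MVT_gen g a b dg) as [c [Hc Heq]].
  - intros x Hx. apply Hd. rewrite Rmin_left, Rmax_right in Hx; lra.
  - intros x Hx. rewrite Rmin_left, Rmax_right in Hx by lra.
    apply continuity_pt_filterlim.
    apply (ex_derive_continuous (K := R_AbsRing) (V := R_NormedModule)).
    exists (dg x). apply Hd; lra.
  - rewrite Rmin_left, Rmax_right in Hc by lra.
    assert (0 <= dg c * (b - a)) by (apply Rmult_le_pos; [apply Hp; lra | lra]).
    lra.
Qed.

Lemma nonincreasing_of_derive (g dg : R -> R) (a b : R) :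
  a <= b ->
  (forall x, a <= x <= b -> is_derive g x (dg x)) ->
  (forall x, a <= x <= b -> dg x <= 0) -> g b <= g a.
Proof.
  intros Hab Hd Hp.
  enough (- g a <= - g b) by lra.
  apply (nondecreasing_of_derive (fun x => - g x) (fun x => - dg x)); trivial.
  - intros x Hx. apply (is_derive_opp g). apply Hd, Hx.
  - intros x Hx. specialize (Hp x Hx). lra.
Qed.

(** * Radial superharmonic functions *)

Definition superharmonic (n : R) (u v w : R -> R) : Prop :=
  forall r, 0 < r ->
    is_derive u r (v r) /\ is_derive v r (w r) /\ 0 < u r /\
    w r + (n - 1) / r * v r <= 0.

(** Divergence form of the radial Laplacian: one-sided bounds on u'' + (n-1)/r u' become
    monotonicity of the flux r^(n-1) u'. *)
Lemma is_derive_flux (n : R) (v : R -> R) (r dv : R) :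
  0 < r -> is_derive v r dv ->
  is_derive (fun s => Rpower s (n - 1) * v s) r
    (Rpower r (n - 1) * (dv + (n - 1) / r * v r)).
Proof.
  intros Hr Hv. evar_last.
  { apply (is_derive_mult (fun s => Rpower s (n - 1)) v).
    - apply is_derive_Rpower; exact Hr.
    - exact Hv.
    - intros; apply Rmult_comm. }
  unfold plus, mult; simpl. field. lra.
Qed.

Lemma superharmonic_flux_decr (n : R) (u v w : R -> R) (a b : R) :
  superharmonic n u v w -> 0 < a <= b ->
  Rpower b (n - 1) * v b <= Rpower a (n - 1) * v a.
Proof.
  intros H Hab.
  apply (nonincreasing_of_derive (fun s => Rpower s (n - 1) * v s)
    (fun r => Rpower r (n - 1) * (w r + (n - 1) / r * v r))); [lra| |].
  - intros x Hx. apply is_derive_flux; [lra|]. apply H; lra.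
  - intros x Hx. destruct (H x) as (_ & _ & _ & Hw); [lra|].
    pose proof (Rpower_pos x (n - 1)). nra.
Qed.

Lemma Rpower_large_at_0 (a M d : R) :
  0 < a -> 0 < d -> exists s, 0 < s <= d /\ M < Rpower s (- a).
Proof.
  intros Ha Hd.
  destruct (Rpower_small a (/ (Rabs M + 1)) Ha) as (e & He & Hs).
  { apply Rinv_0_lt_compat. pose proof (Rabs_pos M). lra. }
  exists (Rmin d e).
  assert (0 < Rmin d e) by (apply Rmin_glb_lt; lra).
  split; [split; [lra | apply Rmin_l]|].
  rewrite Rpower_Ropp.
  specialize (Hs (Rmin d e) (conj H (Rmin_r _ _))).
  apply Rinv_le_contravar in Hs; [|apply Rpower_pos].
  rewrite Rinv_inv in Hs. pose proof (Rle_abs M). lra.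
Qed.

(** r^(2-n) is the fundamental solution; the correction turns a comparison of the flux with the
    constant c into monotonicity. *)
Lemma is_derive_fundamental (n : R) (u : R -> R) (r du c : R) :
  n > 2 -> 0 < r -> is_derive u r du ->
  is_derive (fun s => u s + c / (n - 2) * Rpower s (2 - n)) r
    (du - c / Rpower r (n - 1)).
Proof.
  intros Hn Hr Hu. evar_last.
  { apply (is_derive_plus u (fun s => c / (n - 2) * Rpower s (2 - n))).
    - exact Hu.
    - apply (is_derive_scal (fun s => Rpower s (2 - n))).
      apply is_derive_Rpower; exact Hr. }
  unfold plus; simpl.
  replace (2 - n) with (1 + - (n - 1)) by ring.
  rewrite Rpower_plus, Rpower_Ropp, Rpower_1 by exact Hr.
  pose proof (Rpower_pos r (n - 1)).
  field. repeat split; lra.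
Qed.

(* A positive flux c would force u to drop below zero like -c r^(2-n) at the origin. *)
Lemma superharmonic_derive_nonpos (n : R) (u v w : R -> R) (r : R) :
  n > 2 -> superharmonic n u v w -> 0 < r -> v r <= 0.
Proof.
  intros Hn H Hr. apply Rnot_lt_le; intros Hv.
  set (c := Rpower r (n - 1) * v r).
  assert (Hc : 0 < c) by (apply Rmult_lt_0_compat; [apply Rpower_pos | exact Hv]).
  set (B := u r + c / (n - 2) * Rpower r (2 - n)).
  destruct (Rpower_large_at_0 (n - 2) (B * (n - 2) / c) r) as (s & Hs & HM); [lra|lra|].
  assert (Hle : u s + c / (n - 2) * Rpower s (2 - n) <= B).
  { apply (nondecreasing_of_derive
      (fun s => u s + c / (n - 2) * Rpower s (2 - n))
      (fun x => v x - c / Rpower x (n - 1))); [lra| |].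
    - intros x Hx. apply is_derive_fundamental; [lra|lra|]. apply H; lra.
    - intros x Hx.
      assert (Hf := superharmonic_flux_decr n u v w x r H ltac:(lra)). fold c in Hf.
      pose proof (Rpower_pos x (n - 1)).
      apply (Rmult_le_reg_l (Rpower x (n - 1))); [assumption|].
      replace (Rpower x (n - 1) * (v x - c / Rpower x (n - 1)))
        with (Rpower x (n - 1) * v x - c) by (field; lra). lra. }
  destruct (H s) as (_ & _ & Hus & _); [lra|].
  replace (- (n - 2)) with (2 - n) in HM by ring.
  apply (Rmult_lt_compat_l (c / (n - 2))) in HM; [|apply Rdiv_lt_0_compat; lra].
  replace (c / (n - 2) * (B * (n - 2) / c)) with B in HM by (field; lra).
  lra.
Qed.

Lemma superharmonic_nonincreasing (n : R) (u v w : R -> R) (a b : R) :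
  n > 2 -> superharmonic n u v w -> 0 < a <= b -> u b <= u a.
Proof.
  intros Hn H Hab.
  apply (nonincreasing_of_derive u v); [lra| |].
  - intros x Hx. apply H; lra.
  - intros x Hx. apply (superharmonic_derive_nonpos n u v w); trivial; lra.
Qed.

(* If r u' + (n-2) u is ever negative it stays below a negative constant -c, and u drops below zero like -c ln r at infinity. *)
Lemma superharmonic_scaled_derive_ge (n : R) (u v w : R -> R) (r : R) :
  n > 2 -> superharmonic n u v w -> 0 < r -> 0 <= r * v r + (n - 2) * u r.
Proof.
  intros Hn H Hr. apply Rnot_lt_le; intros Hc.
  set (c := - (r * v r + (n - 2) * u r)).
  assert (Hdec : forall s, r <= s -> s * v s + (n - 2) * u s <= - c).
  { intros s Hs. unfold c; rewrite Ropp_involutive.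
    apply (nonincreasing_of_derive (fun s => s * v s + (n - 2) * u s)
      (fun x => x * (w x + (n - 1) / x * v x))); [exact Hs| |].
    - intros x Hx. destruct (H x) as (Hu & Hv & _); [lra|].
      evar_last.
      { apply (is_derive_plus (fun s => s * v s) (fun s => (n - 2) * u s)).
        - apply (is_derive_mult (fun s => s) v);
            [apply (is_derive_id (K := R_AbsRing)) | exact Hv | intros; apply Rmult_comm].
        - apply (is_derive_scal u). exact Hu. }
      unfold plus, mult, one; simpl. field. lra.
    - intros x Hx. destruct (H x) as (_ & _ & _ & Hw); [lra|]. nra. }
  assert (Hlog : forall s, r <= s -> u s + c * ln s <= u r + c * ln r).
  { intros s Hs.
    apply (nonincreasing_of_derive (fun s => u s + c * ln s)
      (fun x => v x + c * / x)); [exact Hs| |].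
    - intros x Hx. apply (is_derive_plus u (fun s => c * ln s)).
      + apply H; lra.
      + apply (is_derive_scal ln). apply is_derive_ln; lra.
    - intros x Hx. specialize (Hdec x ltac:(lra)).
      destruct (H x) as (_ & _ & Hu & _); [lra|].
      apply (Rmult_le_reg_l x); [lra|].
      replace (x * (v x + c * / x)) with (x * v x + c) by (field; lra).
      nra. }
  assert (Hc' : 0 < c) by (unfold c; lra).
  destruct (H r Hr) as (_ & _ & Hur & _).
  (* With this s, c ln s = c ln r + u r, so [Hlog] gives u s <= 0. *)
  set (s := r * exp (u r / c)).
  assert (0 < u r / c) by (apply Rdiv_lt_0_compat; lra).
  assert (Hs : r <= s).
  { unfold s. pose proof (exp_ineq1_le (u r / c)). nra. }
  specialize (Hlog s Hs). unfold s at 2 in Hlog.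
  rewrite ln_mult, ln_exp in Hlog; [|lra|apply exp_pos].
  destruct (H s) as (_ & _ & Hus & _); [lra|].
  replace (c * (ln r + u r / c)) with (c * ln r + u r) in Hlog by (field; lra).
  lra.
Qed.

(** Substitute for the missing condition u'(0) = 0. A flux below - eps at s stays below it on
    [s, d], so u s would exceed a multiple of s^(2-n), which passes L once s is small. *)
Lemma superharmonic_flux_small (n L : R) (u v w : R -> R) (d eps : R) :
  n > 2 -> superharmonic n u v w -> (forall r, 0 < r -> u r <= L) ->
  0 < d -> 0 < eps ->
  exists s, 0 < s <= d /\ - eps <= Rpower s (n - 1) * v s.
Proof.
  intros Hn H HL Hd He.
  destruct (Rpower_large_at_0 (n - 2)
    ((L + eps / (n - 2) * Rpower d (2 - n)) * (n - 2) / eps) d)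
    as (s & Hs & HM); [lra|lra|].
  exists s. split; [exact Hs|]. apply Rnot_lt_le; intros Hlt.
  assert (Hle : u d + - eps / (n - 2) * Rpower d (2 - n) <= u s + - eps / (n - 2) * Rpower s (2 - n)).
  { apply (nonincreasing_of_derive
      (fun s => u s + - eps / (n - 2) * Rpower s (2 - n))
      (fun x => v x - - eps / Rpower x (n - 1))); [lra| |].
    - intros x Hx. apply is_derive_fundamental; [lra|lra|]. apply H; lra.
    - intros x Hx.
      assert (Hf := superharmonic_flux_decr n u v w s x H ltac:(lra)).
      pose proof (Rpower_pos x (n - 1)).
      apply (Rmult_le_reg_l (Rpower x (n - 1))); [assumption|].
      replace (Rpower x (n - 1) * (v x - - eps / Rpower x (n - 1)))
        with (Rpower x (n - 1) * v x + eps) by (field; lra). lra. }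
  destruct (H d Hd) as (_ & _ & Hud & _).
  specialize (HL s ltac:(lra)).
  replace (- (n - 2)) with (2 - n) in HM by ring.
  apply (Rmult_lt_compat_l (eps / (n - 2))) in HM; [|apply Rdiv_lt_0_compat; lra].
  replace (eps / (n - 2) * ((L + eps / (n - 2) * Rpower d (2 - n)) * (n - 2) / eps))
    with (L + eps / (n - 2) * Rpower d (2 - n)) in HM by (field; lra).
  unfold Rdiv in Hle. rewrite <- !Ropp_mult_distr_l in Hle. fold (Rdiv eps (n-2)) in Hle. lra.
Qed.

(** Performs the passage s -> 0 in inequalities integrated over [s, r]. *)
Lemma le_of_vanishing_power (a c A B r : R) :
  0 < a -> 0 <= c -> 0 < r ->
  (forall s, 0 < s <= r -> B <= A + c * Rpower s a) -> B <= A.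
Proof.
  intros Ha Hc Hr H. apply le_epsilon; intros eps He.
  destruct (Rpower_small a (eps / (c + 1))) as (d & Hd & Hs); [lra| |].
  { apply Rdiv_lt_0_compat; lra. }
  set (s := Rmin r d).
  assert (Hs0 : 0 < s) by (apply Rmin_glb_lt; lra).
  specialize (H s (conj Hs0 (Rmin_l _ _))).
  specialize (Hs s (conj Hs0 (Rmin_r _ _))).
  apply Rle_trans with (1 := H). apply Rplus_le_compat_l.
  apply Rle_trans with (c * (eps / (c + 1))); [apply Rmult_le_compat_l; lra|].
  apply (Rmult_le_reg_r (c + 1)); [lra|].
  replace (c * (eps / (c + 1)) * (c + 1)) with (c * eps) by (field; lra). nra.
Qed.

(** * Integrated bounds near the origin *)

Lemma Rpower_split_weight (n a r : R) :
  0 < r -> Rpower r (n + a) = r * (Rpower r (n - 1) * Rpower r a).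
Proof.
  intros Hr. replace (n + a) with (1 + ((n - 1) + a)) by ring.
  rewrite !Rpower_plus, Rpower_1; auto.
Qed.

Lemma is_derive_scal_Rpower (c a r : R) :
  0 < r -> a <> 0 ->
  is_derive (fun s => c / a * Rpower s a) r (c * Rpower r a / r).
Proof.
  intros Hr Ha. evar_last.
  { apply (is_derive_scal (fun s => Rpower s a)). apply is_derive_Rpower; exact Hr. }
  field; lra.
Qed.

(** On (0, r] monotonicity gives u >= u r, so u^p can be frozen at its value at r while the flux is
    integrated from the origin. The flux at the lower endpoint is dropped because it is
    nonpositive. *)
Lemma derive_upper_bound (n p alpha kap R0 : R) (u v w : R -> R) (r : R) :
  n > 2 -> p > 1 -> alpha > -2 -> 0 < kap -> superharmonic n u v w ->
  (forall s, 0 < s <= R0 ->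
     w s + (n - 1) / s * v s <= - (kap * Rpower s alpha * Rpower (u s) p)) ->
  0 < r <= R0 ->
  v r <= - (kap / (n + alpha) * Rpower (u r) p * (Rpower r (2 + alpha) / r)).
Proof.
  intros Hn Hp Ha Hk H HK Hr.
  set (c := kap * Rpower (u r) p).
  assert (Hc : 0 < c) by (apply Rmult_lt_0_compat; [exact Hk | apply Rpower_pos]).
  assert (Hle : Rpower r (n - 1) * v r + c / (n + alpha) * Rpower r (n + alpha) <= 0).
  { apply (le_of_vanishing_power (n + alpha) (c / (n + alpha)) _ _ r); [lra| |lra|].
    { apply Rlt_le, Rdiv_lt_0_compat; lra. }
    intros s Hs. rewrite Rplus_0_l.
    apply Rle_trans with (Rpower s (n - 1) * v s + c / (n + alpha) * Rpower s (n + alpha)).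
    - apply (nonincreasing_of_derive
        (fun s => Rpower s (n - 1) * v s + c / (n + alpha) * Rpower s (n + alpha))
        (fun s => Rpower s (n - 1) * (w s + (n - 1) / s * v s)
                  + c * Rpower s (n + alpha) / s)); [lra| |].
      + intros x Hx.
        apply (is_derive_plus (fun s => Rpower s (n - 1) * v s)
                 (fun s => c / (n + alpha) * Rpower s (n + alpha))).
        * apply is_derive_flux; [lra|]. apply H; lra.
        * apply is_derive_scal_Rpower; lra.
      + intros x Hx.
        rewrite Rpower_split_weight by lra.
        replace (c * (x * (Rpower x (n - 1) * Rpower x alpha)) / x)
          with (Rpower x (n - 1) * (c * Rpower x alpha)) by (field; lra).
        rewrite <- Rmult_plus_distr_l.
        assert (Hu : u r <= u x) by (apply (superharmonic_nonincreasing n u v w); trivial; lra).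
        assert (Hux : Rpower (u r) p <= Rpower (u x) p).
        { apply Rle_Rpower_l; [lra|]. split; [apply H; lra | exact Hu]. }
        specialize (HK x ltac:(lra)).
        pose proof (Rpower_pos x (n - 1)). pose proof (Rpower_pos x alpha).
        assert (c * Rpower x alpha <= kap * Rpower x alpha * Rpower (u x) p).
        { unfold c. replace (kap * Rpower (u r) p * Rpower x alpha)
            with (kap * Rpower x alpha * Rpower (u r) p) by ring.
          apply Rmult_le_compat_l; [nra|exact Hux]. }
        nra.
    - assert (Hv := superharmonic_derive_nonpos n u v w s Hn H ltac:(lra)).
      pose proof (Rpower_pos s (n - 1)). nra. }
  rewrite Rpower_split_weight in Hle by lra.
  replace (2 + alpha) with (1 + 1 + alpha) by ring.
  rewrite !Rpower_plus, Rpower_1 by lra.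
  pose proof (Rpower_pos r (n - 1)).
  apply (Rmult_le_reg_l (Rpower r (n - 1))); [assumption|].
  apply Rplus_le_reg_r with (c / (n + alpha) * (r * (Rpower r (n - 1) * Rpower r alpha))).
  apply Rle_trans with (1 := Hle). apply Req_le. unfold c. field. lra.
Qed.

(** By [derive_upper_bound], (u^(1-p))' >= c r^(1+alpha). Integration from the origin bounds u^(1-p)
    from below, and the term u(s)^(1-p) > 0 is simply dropped, which is why the bound does not
    depend on the size of u near 0. *)
Lemma scaled_upper_bound (n p alpha kap R0 : R) (u v w : R -> R) (r : R) :
  n > 2 -> p > 1 -> alpha > -2 -> 0 < kap -> superharmonic n u v w ->
  (forall s, 0 < s <= R0 ->
     w s + (n - 1) / s * v s <= - (kap * Rpower s alpha * Rpower (u s) p)) ->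
  0 < r <= R0 ->
  Rpower r ((2 + alpha) / (p - 1)) * u r
    <= Rpower ((n + alpha) * (2 + alpha) / (kap * (p - 1))) (/ (p - 1)).
Proof.
  intros Hn Hp Ha Hk H HK Hr.
  set (c := kap * (p - 1) / (n + alpha)).
  assert (Hc : 0 < c).
  { apply Rdiv_lt_0_compat; [apply Rmult_lt_0_compat|]; lra. }
  assert (Hle : c / (2 + alpha) * Rpower r (2 + alpha) <= Rpower (u r) (1 - p)).
  { apply (le_of_vanishing_power (2 + alpha) (c / (2 + alpha)) _ _ r); [lra| |lra|].
    { apply Rlt_le, Rdiv_lt_0_compat; lra. }
    intros s Hs.
    enough (c / (2 + alpha) * Rpower r (2 + alpha) - Rpower (u r) (1 - p)
            <= c / (2 + alpha) * Rpower s (2 + alpha) - Rpower (u s) (1 - p)).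
    { pose proof (Rpower_pos (u s) (1 - p)). lra. }
    apply (nonincreasing_of_derive
        (fun s => c / (2 + alpha) * Rpower s (2 + alpha) - Rpower (u s) (1 - p))
        (fun s => c * Rpower s (2 + alpha) / s
                  - (1 - p) * Rpower (u s) (1 - p) / u s * v s)); [lra| |].
    - intros x Hx. destruct (H x) as (Hu & _ & Hux & _); [lra|].
      apply (is_derive_minus (fun s => c / (2 + alpha) * Rpower s (2 + alpha))
               (fun s => Rpower (u s) (1 - p))).
      + apply is_derive_scal_Rpower; lra.
      + apply is_derive_Rpower_comp; assumption.
    - intros x Hx. destruct (H x) as (_ & _ & Hux & _); [lra|].
      assert (Hv := derive_upper_bound n p alpha kap R0 u v w x Hn Hp Ha Hk H HK ltac:(lra)).
      assert (Heq : Rpower (u x) (1 - p) / u x = / Rpower (u x) p).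
      { replace (1 - p) with (1 + - p) by ring.
        rewrite Rpower_plus, Rpower_1, Rpower_Ropp by exact Hux.
        pose proof (Rpower_pos (u x) p). field. split; lra. }
      replace ((1 - p) * Rpower (u x) (1 - p) / u x) with ((1 - p) * / Rpower (u x) p)
        by (rewrite <- Heq; unfold Rdiv; ring).
      pose proof (Rpower_pos (u x) p).
      assert (Hi : 0 < / Rpower (u x) p) by (apply Rinv_0_lt_compat; assumption).
      apply (Rmult_le_compat_l ((p - 1) * / Rpower (u x) p)) in Hv; [|nra].
      replace ((p - 1) * / Rpower (u x) p *
        - (kap / (n + alpha) * Rpower (u x) p * (Rpower x (2 + alpha) / x)))
        with (- (c * Rpower x (2 + alpha) / x)) in Hv
        by (unfold c; field; lra).
      lra. }
  destruct (H r) as (_ & _ & Hur & _); [lra|].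
  set (W := Rpower r ((2 + alpha) / (p - 1)) * u r).
  assert (HW : 0 < W) by (apply Rmult_lt_0_compat; [apply Rpower_pos | exact Hur]).
  assert (HQ : Rpower W (p - 1) <= (n + alpha) * (2 + alpha) / (kap * (p - 1))).
  { unfold W. rewrite <- Rpower_mult_distr by (trivial; apply Rpower_pos).
    rewrite Rpower_mult.
    replace ((2 + alpha) / (p - 1) * (p - 1)) with (2 + alpha) by (field; lra).
    replace (1 - p) with (- (p - 1)) in Hle by ring. rewrite Rpower_Ropp in Hle.
    pose proof (Rpower_pos (u r) (p - 1)) as Hq.
    apply (Rmult_le_compat_r (Rpower (u r) (p - 1))) in Hle; [|lra].
    rewrite Rinv_l in Hle by lra.
    apply (Rmult_le_reg_l (c / (2 + alpha))); [apply Rdiv_lt_0_compat; lra|].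
    replace (c / (2 + alpha) * ((n + alpha) * (2 + alpha) / (kap * (p - 1)))) with 1
      by (unfold c; field; lra).
    lra. }
  replace W with (Rpower (Rpower W (p - 1)) (/ (p - 1))).
  - apply Rle_Rpower_l; [apply Rlt_le, Rinv_0_lt_compat; lra|].
    split; [apply Rpower_pos | exact HQ].
  - rewrite Rpower_mult, Rinv_r, Rpower_1; lra.
Qed.

(** The flux is integrated from a radius s given by [superharmonic_flux_small], since here its value
    at the lower endpoint has the unfavourable sign. A and B stand for the contributions of K u^p
    and of mu f. *)
Lemma derive_lower_bound (n alpha nu A B L R0 : R) (u v w : R -> R) (r : R) :
  n > 2 -> alpha > -2 -> nu > -2 -> 0 <= A -> 0 <= B -> superharmonic n u v w ->
  (forall s, 0 < s -> u s <= L) ->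
  (forall s, 0 < s <= R0 ->
     - (A * Rpower s alpha + B * Rpower s nu) <= w s + (n - 1) / s * v s) ->
  0 < r <= R0 ->
  - (A / (n + alpha) * Rpower r (2 + alpha) + B / (n + nu) * Rpower r (2 + nu)) <= r * v r.
Proof.
  intros Hn Ha Hnu HA HB H HL HK Hr.
  set (E := fun s => Rpower s (n - 1) * v s
     + (A / (n + alpha) * Rpower s (n + alpha) + B / (n + nu) * Rpower s (n + nu))).
  assert (HAn : 0 <= A / (n + alpha)) by (apply Rdiv_le_0_compat; lra).
  assert (HBn : 0 <= B / (n + nu)) by (apply Rdiv_le_0_compat; lra).
  assert (Hle : 0 <= E r).
  { apply le_epsilon; intros eps He.
    destruct (superharmonic_flux_small n L u v w r eps Hn H HL) as (s & Hs & Hf); [lra|lra|].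
    assert (HE : E s <= E r).
    { apply (nondecreasing_of_derive E
        (fun s => Rpower s (n - 1) * (w s + (n - 1) / s * v s)
                  + (A * Rpower s (n + alpha) / s + B * Rpower s (n + nu) / s))); [lra| |].
      - intros x Hx. unfold E.
        apply (is_derive_plus (fun s => Rpower s (n - 1) * v s)
          (fun s => A / (n + alpha) * Rpower s (n + alpha) + B / (n + nu) * Rpower s (n + nu))).
        + apply is_derive_flux; [lra|]. apply H; lra.
        + apply (is_derive_plus (fun s => A / (n + alpha) * Rpower s (n + alpha))
                   (fun s => B / (n + nu) * Rpower s (n + nu)));
            apply is_derive_scal_Rpower; lra.
      - intros x Hx. rewrite !Rpower_split_weight by lra.
        replace (A * (x * (Rpower x (n - 1) * Rpower x alpha)) / x
                 + B * (x * (Rpower x (n - 1) * Rpower x nu)) / x)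
          with (Rpower x (n - 1) * (A * Rpower x alpha + B * Rpower x nu)) by (field; lra).
        rewrite <- Rmult_plus_distr_l.
        specialize (HK x ltac:(lra)).
        apply Rmult_le_pos; [apply Rlt_le, Rpower_pos | lra]. }
    unfold E in HE at 1.
    pose proof (Rpower_pos s (n + alpha)). pose proof (Rpower_pos s (n + nu)).
    assert (0 <= A / (n + alpha) * Rpower s (n + alpha)) by (apply Rmult_le_pos; lra).
    assert (0 <= B / (n + nu) * Rpower s (n + nu)) by (apply Rmult_le_pos; lra).
    lra. }
  unfold E in Hle. rewrite !Rpower_split_weight in Hle by lra.
  replace (2 + alpha) with (1 + 1 + alpha) by ring.
  replace (2 + nu) with (1 + 1 + nu) by ring.
  rewrite !Rpower_plus, Rpower_1 by lra.
  pose proof (Rpower_pos r (n - 1)).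
  apply (Rmult_le_reg_l (Rpower r (n - 1))); [assumption|].
  apply (Rmult_le_compat_l r) in Hle; [|lra]. lra.
Qed.

(** Second integration, started at points near the origin where u is within eps of L. *)
Lemma value_lower_bound (n alpha nu A B L R0 : R) (u v w : R -> R) (r : R) :
  n > 2 -> alpha > -2 -> nu > -2 -> 0 <= A -> 0 <= B -> superharmonic n u v w ->
  (forall s, 0 < s -> u s <= L) ->
  (forall d eps, 0 < d -> 0 < eps -> exists s, 0 < s <= d /\ L - eps <= u s) ->
  (forall s, 0 < s <= R0 ->
     - (A * Rpower s alpha + B * Rpower s nu) <= w s + (n - 1) / s * v s) ->
  0 < r <= R0 ->
  L <= u r + (A / (n + alpha) / (2 + alpha) * Rpower r (2 + alpha)
              + B / (n + nu) / (2 + nu) * Rpower r (2 + nu)).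
Proof.
  intros Hn Ha Hnu HA HB H HL Hlim HK Hr.
  set (E := fun s => u s + (A / (n + alpha) / (2 + alpha) * Rpower s (2 + alpha)
              + B / (n + nu) / (2 + nu) * Rpower s (2 + nu))).
  assert (HAn : 0 <= A / (n + alpha)) by (apply Rdiv_le_0_compat; lra).
  assert (HBn : 0 <= B / (n + nu)) by (apply Rdiv_le_0_compat; lra).
  apply le_epsilon; intros eps He. fold (E r).
  destruct (Hlim r eps) as (s & Hs & Hu); [lra|lra|].
  assert (HE : E s <= E r).
  { apply (nondecreasing_of_derive E
      (fun s => v s + (A / (n + alpha) * Rpower s (2 + alpha) / s
                       + B / (n + nu) * Rpower s (2 + nu) / s))); [lra| |].
    - intros x Hx. unfold E.
      apply (is_derive_plus u
        (fun s => A / (n + alpha) / (2 + alpha) * Rpower s (2 + alpha)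
                  + B / (n + nu) / (2 + nu) * Rpower s (2 + nu))).
      + apply H; lra.
      + apply (is_derive_plus (fun s => A / (n + alpha) / (2 + alpha) * Rpower s (2 + alpha))
                 (fun s => B / (n + nu) / (2 + nu) * Rpower s (2 + nu)));
          apply is_derive_scal_Rpower; lra.
    - intros x Hx.
      assert (Hd := derive_lower_bound n alpha nu A B L R0 u v w x
                      Hn Ha Hnu HA HB H HL HK ltac:(lra)).
      apply (Rmult_le_reg_l x); [lra|].
      apply Rle_trans with (x * v x + (A / (n + alpha) * Rpower x (2 + alpha)
                       + B / (n + nu) * Rpower x (2 + nu))); [lra|].
      apply Req_le. field. lra. }
  unfold E in HE at 1.
  pose proof (Rpower_pos s (2 + alpha)). pose proof (Rpower_pos s (2 + nu)).
  assert (0 <= A / (n + alpha) / (2 + alpha)) by (apply Rdiv_le_0_compat; lra).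
  assert (0 <= B / (n + nu) / (2 + nu)) by (apply Rdiv_le_0_compat; lra).
  nra.
Qed.

(** * A strict Lyapunov function *)

Lemma continuous_eps (g : R -> R) (x eps : R) :
  continuous g x -> 0 < eps ->
  exists d, 0 < d /\ forall y, Rabs (y - x) < d -> Rabs (g y - g x) < eps.
Proof.
  intros Hc He.
  apply (filterlim_locally (F := locally x) g (g x)) with (eps := mkposreal eps He) in Hc.
  destruct Hc as [d Hd]. exists d. split; [apply cond_pos|].
  intros y Hy. exact (Hd y Hy).
Qed.

Lemma is_derive_continuous (g : R -> R) (x l : R) : is_derive g x l -> continuous g x.
Proof.
  intros H. apply (ex_derive_continuous (K := R_AbsRing) (V := R_NormedModule)).
  exists l. exact H.
Qed.

(** Barrier argument that uses the derivative only on the zero set of g. If g b > 0, let s be the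
    supremum of the points with g <= 0. Continuity excludes g s < 0 and g s > 0, and at g s = 0 the
    negative derivative produces negative values to the right of s. *)
Lemma nonpos_invariant (g dg : R -> R) (a b : R) :
  a <= b ->
  (forall x, a <= x <= b -> is_derive g x (dg x)) ->
  g a <= 0 ->
  (forall x, a <= x <= b -> g x = 0 -> dg x < 0) ->
  g b <= 0.
Proof.
  intros Hab Hd Ha H0. apply Rnot_lt_le; intros Hb.
  set (E := fun x => a <= x <= b /\ g x <= 0).
  destruct (completeness E) as [s [Hub Hlub]].
  { exists b. intros x [Hx _]. lra. }
  { exists a. split; [lra|exact Ha]. }
  assert (Has : a <= s) by (apply Hub; split; lra).
  assert (Hsb : s <= b) by (apply Hlub; intros x [Hx _]; lra).
  assert (Hc : continuous g s) by (apply is_derive_continuous with (dg s); apply Hd; lra).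
  assert (Hgt : forall x, s < x <= b -> 0 < g x).
  { intros x Hx. apply Rnot_le_lt; intros Hg.
    assert (x <= s) by (apply Hub; split; lra). lra. }
  destruct (Rtotal_order (g s) 0) as [Hs|[Hs|Hs]].
  - destruct (continuous_eps g s (- g s) Hc) as (d & Hd0 & Hdd); [lra|].
    assert (s < b) by (destruct (Req_dec s b); [subst; lra|lra]).
    assert (Hm : 0 < Rmin (d / 2) (b - s)) by (apply Rmin_glb_lt; lra).
    pose proof (Rmin_l (d / 2) (b - s)). pose proof (Rmin_r (d / 2) (b - s)).
    specialize (Hdd (s + Rmin (d / 2) (b - s))).
    specialize (Hgt (s + Rmin (d / 2) (b - s)) ltac:(lra)).
    assert (HA : Rabs (s + Rmin (d / 2) (b - s) - s) < d) by (rewrite Rabs_pos_eq; lra).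
    apply Hdd, Rabs_def2 in HA. lra.
  - assert (Hneg := H0 s ltac:(lra) Hs).
    assert (Hder := Hd s ltac:(lra)). apply is_derive_Reals in Hder.
    destruct (Hder (- dg s) ltac:(lra)) as [d Hdd].
    pose proof (cond_pos d).
    assert (s < b) by (destruct (Req_dec s b); [subst; lra|lra]).
    set (h := Rmin (d / 2) (b - s)).
    assert (Hm : 0 < h) by (apply Rmin_glb_lt; lra).
    assert (h <= d / 2) by apply Rmin_l. assert (h <= b - s) by apply Rmin_r.
    specialize (Hdd h ltac:(lra)). specialize (Hgt (s + h) ltac:(lra)).
    assert (HA : Rabs h < d) by (rewrite Rabs_pos_eq; lra).
    apply Hdd, Rabs_def2 in HA. destruct HA as [HA _].
    rewrite Hs in HA.
    assert (0 < (g (s + h) - 0) / h) by (apply Rdiv_lt_0_compat; lra). lra.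
  - destruct (continuous_eps g s (g s) Hc Hs) as (d & Hd0 & Hdd).
    assert (s <= s - d); [|lra].
    apply Hlub. intros x [Hx Hg]. apply Rnot_lt_le; intros Hlt.
    assert (x <= s) by (apply Hub; split; lra).
    assert (HA : Rabs (x - s) < d) by (rewrite Rabs_left1; lra).
    apply Hdd, Rabs_def2 in HA. lra.
Qed.

(** W^p is split as W^(p-1) W so that W^(p-1) can be bounded as a coefficient in polynomial
    estimates. *)
Definition force (b k0 p W : R) : R := - b * W + k0 * Rpower W (p - 1) * W.

(* The energy of W'' + a W' + force W = 0 (with ' = d/d(ln r)), plus the cross term eta Z (force W), which makes the dissipation strict in both Z and (force W). *)
Definition lyap (b k0 p eta W Z : R) : R :=
  Z ^ 2 / 2 - b * W ^ 2 / 2 + k0 / (p + 1) * Rpower W (p - 1) * W ^ 2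
  + eta * Z * force b k0 p W.

Lemma is_derive_lyap (b k0 p eta : R) (W Z : R -> R) (r dW dZ : R) :
  p > 1 -> 0 < W r -> is_derive W r dW -> is_derive Z r dZ ->
  is_derive (fun s => lyap b k0 p eta (W s) (Z s)) r
    (Z r * dZ + force b k0 p (W r) * dW
     + eta * (dZ * force b k0 p (W r)
              + Z r * ((- b + k0 * p * Rpower (W r) (p - 1)) * dW))).
Proof.
  intros Hp HW HdW HdZ.
  assert (HdQ := is_derive_Rpower_comp W (p - 1) r dW HW HdW).
  unfold lyap, force.
  (* Naming the power makes the expression polynomial in W, Z and Q, which [auto_derive] can handle;
     the derivative of Q is supplied by [HdQ]. *)
  set (Q := fun s => Rpower (W s) (p - 1)).
  change (is_derive Q r ((p - 1) * Q r / W r * dW)) in HdQ.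
  change (is_derive
    (fun s => Z s ^ 2 / 2 - b * W s ^ 2 / 2 + k0 / (p + 1) * Q s * W s ^ 2
              + eta * Z s * (- b * W s + k0 * Q s * W s)) r
    (Z r * dZ + (- b * W r + k0 * Q r * W r) * dW
     + eta * (dZ * (- b * W r + k0 * Q r * W r)
              + Z r * ((- b + k0 * p * Q r) * dW)))).
  auto_derive.
  - repeat split; eexists; eassumption.
  - replace (Derive (fun x => Z x) r) with dZ by (symmetry; apply is_derive_unique; exact HdZ).
    replace (Derive (fun x => W x) r) with dW by (symmetry; apply is_derive_unique; exact HdW).
    replace (Derive (fun x => Q x) r) with ((p - 1) * Q r / W r * dW)
      by (symmetry; apply is_derive_unique; exact HdQ).
    field. lra.
Qed.

(** Here g is the force, g1 its derivative and P the perturbation. In the energy part g Z cancels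
    and leaves - a Z^2 - Z P. The cross term yields - eta g^2 together with eta g1 Z^2 and - a eta Z
    g; a small eta lets each of these two cost at most a/4 Z^2, the second also eta/2 g^2. *)
Lemma lyap_dissipation (a eta Z g g1 G1 P : R) :
  0 < a -> 0 < eta <= 1 / 2 -> eta * G1 <= a / 4 -> 2 * a * eta <= 1 -> Rabs g1 <= G1 ->
  Z * (- a * Z - g - P) + g * Z + eta * ((- a * Z - g - P) * g + Z * (g1 * Z))
  <= - (a / 2) * Z ^ 2 - eta / 2 * g ^ 2 + (Rabs Z + Rabs g) * Rabs P.
Proof.
  intros Ha He HG Hae Hg1.
  assert (H1 : eta * g1 * Z ^ 2 <= a / 4 * Z ^ 2).
  { apply Rmult_le_compat_r; [nra|]. pose proof (Rle_abs g1). nra. }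
  assert (H2 : - a * eta * Z * g <= a / 4 * Z ^ 2 + eta / 2 * g ^ 2).
  { assert (0 <= a * (Z / 2 + eta * g) ^ 2) by (apply Rmult_le_pos; [lra|apply pow2_ge_0]).
    assert (a * eta * eta * g ^ 2 <= eta / 2 * g ^ 2).
    { apply Rmult_le_compat_r; [apply pow2_ge_0|nra]. }
    nra. }
  assert (H3 : - Z * P - eta * g * P <= (Rabs Z + Rabs g) * Rabs P).
  { assert (- Z * P <= Rabs Z * Rabs P)
      by (rewrite <- Rabs_mult, <- (Rabs_Ropp (Z * P)), Ropp_mult_distr_l; apply Rle_abs).
    assert (- g * P <= Rabs g * Rabs P)
      by (rewrite <- Rabs_mult, <- (Rabs_Ropp (g * P)), Ropp_mult_distr_l; apply Rle_abs).
    pose proof (Rmult_le_pos _ _ (Rabs_pos g) (Rabs_pos P)). nra. }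
  nra.
Qed.

(** Subtracting W force/(p+1) removes the power W^(p+1). Where Z and the force are both small, the
    level thus determines W^2 up to a small error. *)
Lemma lyap_virial (b k0 p eta W Z : R) :
  p > 1 ->
  lyap b k0 p eta W Z
  = Z ^ 2 / 2 + eta * Z * force b k0 p W + W * force b k0 p W / (p + 1)
    - b * (p - 1) / (2 * (p + 1)) * W ^ 2.
Proof. intros Hp. unfold lyap, force. field. lra. Qed.

(** If Z and the force were both below s at level - delta, [lyap_virial] would give B W^2 close to
    delta. For small delta this puts W in (0, w0], where the linear part dominates and |force| >= b
    W / 2; but W is not small compared with s, a contradiction. *)
Lemma lyap_level_gap (b k0 p C eta : R) :
  0 < b -> 0 < k0 -> p > 1 -> 0 < C -> 0 < eta <= 1 / 2 ->
  exists delta0, 0 < delta0 /\ forall delta, 0 < delta <= delta0 ->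
    exists s, 0 < s /\ forall W Z, 0 < W <= C ->
      lyap b k0 p eta W Z = - delta -> s <= Rabs Z \/ s <= Rabs (force b k0 p W).
Proof.
  intros Hb Hk Hp HC He.
  set (B := b * (p - 1) / (2 * (p + 1))).
  assert (HB : 0 < B) by (apply Rdiv_lt_0_compat; [apply Rmult_lt_0_compat|]; lra).
  destruct (Rpower_small (p - 1) (b / (2 * k0))) as (w0 & Hw0 & Hsmall); [lra| |].
  { apply Rdiv_lt_0_compat; lra. }
  (* The factor 1/2 makes B W^2 <= 2 delta imply W <= w0. *)
  exists (B * w0 ^ 2 / 2). split; [apply Rdiv_lt_0_compat; [apply Rmult_lt_0_compat|]; nra|].
  intros delta Hdel.
  (* s1 makes the first three terms of the virial form at most delta / 2; s2 is the lower bound for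
     (b W / 2)^2 implied by B W^2 >= delta / 2. *)
  set (s1 := delta / (2 * (1 + C))). set (s2 := b ^ 2 * delta / (8 * B)).
  assert (Hs1 : 0 < s1) by (apply Rdiv_lt_0_compat; lra).
  assert (Hs2 : 0 < s2) by (apply Rdiv_lt_0_compat; [apply Rmult_lt_0_compat; nra|lra]).
  set (s := Rmin 1 (Rmin s1 s2)).
  assert (Hs : 0 < s) by (repeat apply Rmin_glb_lt; lra).
  assert (Hsl1 : s <= 1) by apply Rmin_l.
  assert (Hsl2 : s <= s1) by (eapply Rle_trans; [apply Rmin_r | apply Rmin_l]).
  assert (Hsl3 : s <= s2) by (eapply Rle_trans; [apply Rmin_r | apply Rmin_r]).
  exists s. split; [exact Hs|]. intros W Z HW HV.
  rewrite lyap_virial in HV by exact Hp. fold B in HV.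
  set (g := force b k0 p W) in *.
  destruct (Rle_dec s (Rabs Z)) as [|HZ]; [now left|]. right.
  apply Rnot_lt_le; intros Hg. apply Rnot_le_lt in HZ.
  apply Rabs_def2 in HZ. pose proof (Rabs_def2 _ _ Hg) as Hg'.
  assert (HZ2 : Z ^ 2 <= s ^ 2) by nra.
  assert (Hg2 : g ^ 2 < s ^ 2) by nra.
  assert (Hs12 : (1 + C) * s <= delta / 2).
  { apply Rle_trans with ((1 + C) * s1); [apply Rmult_le_compat_l; lra|].
    apply Req_le. unfold s1. field. lra. }
  assert (HT1 : - s <= Z ^ 2 / 2 + eta * Z * g <= s).
  { assert (HZg : Rabs (Z * g) <= s * s).
    { rewrite Rabs_mult. apply Rmult_le_compat; try apply Rabs_pos; [apply Rabs_le; lra | lra]. }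
    assert (HeZg : Rabs (eta * (Z * g)) <= 1 / 2 * (s * s)).
    { rewrite Rabs_mult, (Rabs_pos_eq eta) by lra.
      apply Rmult_le_compat; try apply Rabs_pos; lra. }
    apply Rabs_le_between in HeZg. pose proof (pow2_ge_0 Z).
    assert (s * s <= s) by nra. lra. }
  assert (HT2 : - (C * s) <= W * g / (p + 1) <= C * s).
  { assert (HWg : Rabs (W * g) <= C * s).
    { rewrite Rabs_mult, (Rabs_pos_eq W) by lra. apply Rmult_le_compat; try apply Rabs_pos; lra. }
    apply Rabs_le_between in HWg.
    assert (HCs : 0 < C * s) by nra.
    split; apply (Rmult_le_reg_r (p + 1)); try lra;
      unfold Rdiv; rewrite Rmult_assoc, Rinv_l, Rmult_1_r by lra; nra. }
  assert (HBW : delta / 2 <= B * W ^ 2 <= 2 * delta) by nra.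
  assert (HWw : W <= w0).
  { apply Rnot_lt_le; intros Hlt.
    assert (w0 ^ 2 < W ^ 2) by nra.
    assert (B * w0 ^ 2 < B * W ^ 2) by (apply Rmult_lt_compat_l; lra).
    lra. }
  specialize (Hsmall W ltac:(lra)).
  assert (HkQ : k0 * Rpower W (p - 1) <= b / 2).
  { apply (Rmult_le_compat_l k0) in Hsmall; [|lra].
    replace (k0 * (b / (2 * k0))) with (b / 2) in Hsmall by (field; lra). lra. }
  assert (Hgl : g <= - (b / 2) * W) by (unfold g, force; nra).
  assert (Hfin : b ^ 2 * W ^ 2 / 4 < s).
  { assert ((b / 2 * W) ^ 2 <= (- g) ^ 2) by (apply pow_incr; split; [nra|lra]). nra. }
  assert (s2 <= b ^ 2 * W ^ 2 / 4).
  { unfold s2. apply (Rmult_le_reg_r (8 * B)); [lra|].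
    replace (b ^ 2 * delta / (8 * B) * (8 * B)) with (b ^ 2 * delta) by (field; lra).
    assert (b ^ 2 * (delta / 2) <= b ^ 2 * (B * W ^ 2)) by (apply Rmult_le_compat_l; nra).
    nra. }
  lra.
Qed.

(* Near the unstable direction Z = theta W of the origin the energy is about (theta^2 - b) W^2 / 2 = - theta a W^2 / 2; this is where p > p_S enters. *)
Lemma lyap_entry (a theta k0 p eta : R) :
  0 < a -> 0 < theta -> 0 < k0 -> p > 1 -> 0 < eta ->
  exists tau, 0 < tau /\ forall W Z, 0 < W -> Rpower W (p - 1) <= tau ->
    Rabs (Z - theta * W) <= tau * W ->
    lyap (theta * (theta + a)) k0 p eta W Z <= - (theta * a / 4) * W ^ 2.
Proof.
  intros Ha Hth Hk Hp He. set (b := theta * (theta + a)).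
  assert (Hb : 0 < b) by (apply Rmult_lt_0_compat; lra).
  set (t1 := theta * a / 4 / (theta + 1 + k0)).
  assert (Hta : 0 < theta * a) by nra.
  assert (Ht1 : 0 < t1) by (apply Rdiv_lt_0_compat; lra).
  assert (Hbk : 0 < b / k0) by (apply Rdiv_lt_0_compat; lra).
  (* tau <= theta gives Z >= 0 and tau <= b / k0 gives force <= 0, so the cross term is nonpositive;
     tau <= 1 and tau <= t1 keep the quadratic coefficient below - theta a / 4. *)
  set (tau := Rmin (Rmin 1 theta) (Rmin t1 (b / k0))).
  assert (Htau : 0 < tau) by (repeat apply Rmin_glb_lt; lra).
  assert (H1 : tau <= 1) by (eapply Rle_trans; [apply Rmin_l | apply Rmin_l]).
  assert (H2 : tau <= theta) by (eapply Rle_trans; [apply Rmin_l | apply Rmin_r]).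
  assert (H3 : tau <= t1) by (eapply Rle_trans; [apply Rmin_r | apply Rmin_l]).
  assert (H4 : tau <= b / k0) by (eapply Rle_trans; [apply Rmin_r | apply Rmin_r]).
  exists tau. split; [exact Htau|]. intros W Z HW HQ HZ.
  apply Rabs_le_between in HZ.
  set (Q := Rpower W (p - 1)) in *.
  assert (HQ0 : 0 < Q) by apply Rpower_pos.
  assert (HZ0 : 0 <= Z) by nra.
  assert (HkQ : k0 * Q <= b).
  { apply Rle_trans with (k0 * (b / k0)); [apply Rmult_le_compat_l; lra|].
    apply Req_le; field; lra. }
  assert (Hcross : eta * Z * force b k0 p W <= 0).
  { unfold force. fold Q.
    assert (0 <= eta * Z) by nra.
    assert (- b * W + k0 * Q * W <= 0) by nra. nra. }
  assert (HZ2 : Z ^ 2 <= (theta + tau) ^ 2 * W ^ 2).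
  { replace ((theta + tau) ^ 2 * W ^ 2) with (((theta + tau) * W) ^ 2) by ring.
    apply pow_incr. split; [exact HZ0|lra]. }
  assert (Hpot : k0 / (p + 1) * Q * W ^ 2 <= k0 * tau * W ^ 2).
  { apply Rmult_le_compat_r; [apply pow2_ge_0|].
    apply Rmult_le_compat; [apply Rlt_le, Rdiv_lt_0_compat; lra | lra | | exact HQ].
    apply (Rmult_le_reg_r (p + 1)); [lra|].
    unfold Rdiv; rewrite Rmult_assoc, Rinv_l by lra. nra. }
  assert (Htt : tau * (theta + 1 + k0) <= theta * a / 4).
  { apply Rle_trans with (t1 * (theta + 1 + k0)); [apply Rmult_le_compat_r; lra|].
    apply Req_le. unfold t1. field. lra. }
  unfold lyap. fold Q.
  assert (Hcoef : (theta + tau) ^ 2 / 2 - b / 2 + k0 * tau <= - (theta * a / 4)).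
  { unfold b. nra. }
  apply (Rmult_le_compat_r (W ^ 2)) in Hcoef; [|apply pow2_ge_0].
  nra.
Qed.

(** In the cone |Z| <= H W, [lyap] is at least a negative multiple of W^2, so a level <= - delta
    keeps W away from 0. *)
Lemma lyap_lower (b k0 p eta H Qm W Z : R) :
  0 < b -> 0 < k0 -> p > 1 -> 0 < eta -> 0 < W -> 0 <= H ->
  Rabs Z <= H * W -> Rpower W (p - 1) <= Qm ->
  - ((b / 2 + eta * H * (b + k0 * Qm)) * W ^ 2) <= lyap b k0 p eta W Z.
Proof.
  intros Hb Hk Hp He HW HH HZ HQ. unfold lyap.
  set (Q := Rpower W (p - 1)) in *. assert (HQ0 : 0 < Q) by apply Rpower_pos.
  assert (Hg : Rabs (force b k0 p W) <= (b + k0 * Qm) * W).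
  { unfold force. fold Q. apply Rabs_le.
    assert (0 < k0 * Q * W) by (repeat apply Rmult_lt_0_compat; lra).
    assert (k0 * Q * W <= k0 * Qm * W) by (apply Rmult_le_compat_r; nra). nra. }
  assert (HZg : Rabs (Z * force b k0 p W) <= H * (b + k0 * Qm) * W ^ 2).
  { rewrite Rabs_mult. apply Rle_trans with ((H * W) * ((b + k0 * Qm) * W)).
    - apply Rmult_le_compat; try apply Rabs_pos; assumption.
    - apply Req_le; ring. }
  apply Rabs_le_between in HZg.
  assert (0 <= k0 / (p + 1) * Q * W ^ 2).
  { assert (0 < k0 / (p + 1)) by (apply Rdiv_lt_0_compat; lra).
    apply Rmult_le_pos; [nra|apply pow2_ge_0]. }
  pose proof (pow2_ge_0 Z). nra.
Qed.

(** On the level - delta the dissipation is at least min(a/2, eta/2) s^2, while the perturbation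
    contributes at most (H C + Gm) eps, which is smaller. Only this pointwise comparison enters, so
    no constant depends on r0 / r1. *)
Lemma lyap_trapping (a b k0 p C H eta G1 Gm eps delta s r1 r0 : R) (W Z P : R -> R) :
  0 < a -> p > 1 -> 0 < C -> 0 <= H -> 0 < eta <= 1 / 2 ->
  eta * G1 <= a / 4 -> 2 * a * eta <= 1 -> 0 < s -> 0 <= Gm ->
  (H * C + Gm) * eps < Rmin (a / 2) (eta / 2) * s ^ 2 ->
  (forall w, 0 < w <= C -> Rabs (force b k0 p w) <= Gm) ->
  (forall w, 0 < w <= C -> Rabs (- b + k0 * p * Rpower w (p - 1)) <= G1) ->
  (forall w z, 0 < w <= C -> lyap b k0 p eta w z = - delta ->
     s <= Rabs z \/ s <= Rabs (force b k0 p w)) ->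
  0 < r1 <= r0 ->
  (forall r, r1 <= r <= r0 ->
     0 < W r <= C /\ Rabs (Z r) <= H * W r /\ Rabs (P r) <= eps /\
     is_derive W r (Z r / r) /\
     is_derive Z r ((- a * Z r - force b k0 p (W r) - P r) / r)) ->
  lyap b k0 p eta (W r1) (Z r1) <= - delta ->
  lyap b k0 p eta (W r0) (Z r0) <= - delta.
Proof.
  intros Ha Hp HC HH He HeG Hae Hs HGm Heps HGm' HG1 Hgap Hr Hode Hinit.
  enough (lyap b k0 p eta (W r0) (Z r0) + delta <= 0) by lra.
  set (D := fun r => Z r * (- a * Z r - force b k0 p (W r) - P r) + force b k0 p (W r) * Z r
     + eta * ((- a * Z r - force b k0 p (W r) - P r) * force b k0 p (W r)
              + Z r * ((- b + k0 * p * Rpower (W r) (p - 1)) * Z r))).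
  apply (nonpos_invariant (fun r => lyap b k0 p eta (W r) (Z r) + delta) (fun r => D r / r) r1);
    [lra| |lra|].
  - intros r Hrr. destruct (Hode r Hrr) as (HW & _ & _ & HdW & HdZ).
    evar_last.
    { apply (is_derive_plus (fun r => lyap b k0 p eta (W r) (Z r)) (fun _ => delta)).
      - apply is_derive_lyap; [exact Hp|lra|exact HdW|exact HdZ].
      - apply (is_derive_const (K := R_AbsRing)). }
    unfold plus, zero; simpl. unfold D. field. lra.
  - intros r Hrr Hlev. destruct (Hode r Hrr) as (HW & HZ & HP & _ & _).
    assert (HD : D r < 0).
    { unfold D. set (g := force b k0 p (W r)).
      eapply Rle_lt_trans.
      { apply lyap_dissipation with (G1 := G1); trivial. apply HG1, HW. }
      assert (Hg := HGm' (W r) HW). fold g in Hg.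
      assert (HPb : (Rabs (Z r) + Rabs g) * Rabs (P r) <= (H * C + Gm) * eps).
      { assert (Rabs (Z r) <= H * C) by nra.
        pose proof (Rabs_pos (Z r)). pose proof (Rabs_pos g).
        apply Rmult_le_compat; try apply Rabs_pos; lra. }
      assert (Hgap' : s ^ 2 <= Z r ^ 2 + g ^ 2).
      { rewrite <- (pow2_abs (Z r)), <- (pow2_abs g).
        pose proof (pow2_ge_0 (Rabs (Z r))). pose proof (pow2_ge_0 (Rabs g)).
        destruct (Hgap (W r) (Z r) HW ltac:(lra)) as [Hz|Hz]; fold g in Hz;
          pose proof (pow_incr s _ 2 (conj (Rlt_le _ _ Hs) Hz)); lra. }
      set (c := Rmin (a / 2) (eta / 2)) in *.
      assert (c <= a / 2) by apply Rmin_l. assert (c <= eta / 2) by apply Rmin_r.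
      assert (0 < c) by (apply Rmin_glb_lt; lra).
      pose proof (pow2_ge_0 (Z r)). pose proof (pow2_ge_0 g).
      assert (c * s ^ 2 <= c * (Z r ^ 2 + g ^ 2)) by (apply Rmult_le_compat_l; lra).
      nra. }
    unfold Rdiv. assert (0 < / r) by (apply Rinv_0_lt_compat; lra). nra.
Qed.

(** * Emden-Fowler variables *)

Definition accel (n p mu : R) (K f u v : R -> R) (r : R) : R :=
  - ((n - 1) / r * v r) - K r * Rpower (u r) p - mu * f r.

Definition radial_solution (n p mu : R) (K f u v : R -> R) : Prop :=
  forall r, 0 < r ->
    is_derive u r (v r) /\ is_derive v r (accel n p mu K f u v r) /\ 0 < u r.

(** For a nonincreasing u this expresses u(0) = L in the form used by the integrations from the
    origin. *)
Definition sup_at_0 (u : R -> R) (L : R) : Prop :=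
  (forall s, 0 < s -> u s <= L) /\
  (forall d eps, 0 < d -> 0 < eps -> exists s, 0 < s <= d /\ L - eps <= u s).

Lemma radial_superharmonic (n p mu : R) (K f u v : R -> R) :
  mu >= 0 -> (forall r, 0 < r -> 0 < K r) -> (forall r, 0 < r -> 0 <= f r) ->
  radial_solution n p mu K f u v -> superharmonic n u v (accel n p mu K f u v).
Proof.
  intros Hmu HK Hf H r Hr. destruct (H r Hr) as (Hu & Hv & Hp).
  do 3 (split; [assumption|]). unfold accel.
  specialize (HK r Hr). specialize (Hf r Hr). pose proof (Rpower_pos (u r) p).
  assert (0 < K r * Rpower (u r) p) by (apply Rmult_lt_0_compat; assumption).
  assert (0 <= mu * f r) by (apply Rmult_le_pos; lra).
  lra.
Qed.

Lemma K0_near (K : R -> R) (alpha k0 eps : R) :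
  K0_hyp K alpha k0 -> 0 < eps ->
  exists d, 0 < d /\ forall s, 0 < s <= d -> Rabs (K s / Rpower s alpha - k0) <= eps.
Proof.
  intros (_ & _ & _ & _ & Hlim) He.
  apply (filterlim_locally (F := at_right 0) _ k0) with (eps := mkposreal eps He) in Hlim.
  destruct Hlim as [d Hd]. exists (d / 2). pose proof (cond_pos d).
  split; [lra|]. intros s Hs. apply Rlt_le, (Hd s); [|lra].
  change (Rabs (s - 0) < d). rewrite Rminus_0_r, Rabs_pos_eq; lra.
Qed.

Lemma F0_near (f : R -> R) (nu : R) :
  F0_hyp f nu ->
  exists Cf d, 0 <= Cf /\ 0 < d /\ forall s, 0 < s <= d -> f s <= Cf * Rpower s nu.
Proof.
  intros (_ & _ & _ & _ & C & d & Hd & HC).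
  exists (Rabs C), (d / 2). split; [apply Rabs_pos|]. split; [lra|].
  intros s Hs. specialize (HC s ltac:(lra)).
  pose proof (Rle_abs (f s)). pose proof (Rle_abs C). pose proof (Rpower_pos s nu). nra.
Qed.

Definition EF_W (theta : R) (u : R -> R) (r : R) : R := Rpower r theta * u r.
Definition EF_Z (theta : R) (u v : R -> R) (r : R) : R :=
  theta * EF_W theta u r + Rpower r theta * (r * v r).
(** The o(1) terms of the autonomous equation: the deviation of K from k0 r^alpha times W^p, and the
    source, of order r^(theta + 2 + nu). *)
Definition EF_P (p mu alpha k0 theta : R) (K f u : R -> R) (r : R) : R :=
  (K r / Rpower r alpha - k0) * (Rpower (EF_W theta u r) (p - 1) * EF_W theta u r)
  + mu * (Rpower r (2 + theta) * f r).

Lemma is_derive_EF_W (n p mu theta : R) (K f u v : R -> R) (r : R) :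
  radial_solution n p mu K f u v -> 0 < r ->
  is_derive (EF_W theta u) r (EF_Z theta u v r / r).
Proof.
  intros H Hr. destruct (H r Hr) as (Hu & _ & _). unfold EF_Z, EF_W. evar_last.
  { apply (is_derive_mult (fun s => Rpower s theta) u);
      [apply is_derive_Rpower; exact Hr | exact Hu | intros; apply Rmult_comm]. }
  unfold plus, mult; simpl. field. lra.
Qed.

Lemma Rpower_EF_W (p alpha theta : R) (u : R -> R) (r : R) :
  theta * (p - 1) = 2 + alpha -> 0 < r -> 0 < u r ->
  Rpower (EF_W theta u r) (p - 1) = Rpower r (2 + alpha) * Rpower (u r) (p - 1).
Proof.
  intros Hth Hr Hu. unfold EF_W.
  rewrite <- Rpower_mult_distr by (trivial; apply Rpower_pos).
  rewrite Rpower_mult, Hth. reflexivity.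
Qed.

(** The choice theta (p - 1) = 2 + alpha makes r^(2+theta) K u^p equal to (K / r^alpha) W^p. The
    damping is a = n - 2 - 2 theta and b = theta (theta + a) = theta (n - 2 - theta). *)
Lemma is_derive_EF_Z (n p mu alpha k0 theta : R) (K f u v : R -> R) (r : R) :
  theta * (p - 1) = 2 + alpha ->
  radial_solution n p mu K f u v -> 0 < r ->
  is_derive (EF_Z theta u v) r
    ((- (n - 2 - 2 * theta) * EF_Z theta u v r
      - force (theta * (theta + (n - 2 - 2 * theta))) k0 p (EF_W theta u r)
      - EF_P p mu alpha k0 theta K f u r) / r).
Proof.
  intros Hth H Hr. destruct (H r Hr) as (Hu & Hv & Hp).
  evar_last.
  { unfold EF_Z. apply (is_derive_plus (fun s => theta * EF_W theta u s)
      (fun s => Rpower s theta * (s * v s))).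
    - apply (is_derive_scal (EF_W theta u)). apply (is_derive_EF_W n p mu theta K f u v r H Hr).
    - apply (is_derive_mult (fun s => Rpower s theta) (fun s => s * v s));
        [apply is_derive_Rpower; exact Hr | | intros; apply Rmult_comm].
      apply (is_derive_mult (fun s => s) v);
        [apply (is_derive_id (K := R_AbsRing)) | exact Hv | intros; apply Rmult_comm]. }
  unfold plus, mult, one; simpl. unfold force, EF_P.
  rewrite (Rpower_EF_W p alpha) by assumption.
  rewrite (Rpower_div_self (u r) p) by exact Hp.
  unfold EF_Z, EF_W, accel.
  replace (2 + alpha) with (1 + 1 + alpha) by ring.
  replace (2 + theta) with (1 + 1 + theta) by ring.
  rewrite !Rpower_plus, Rpower_1 by exact Hr.
  pose proof (Rpower_pos r alpha). field. lra.
Qed.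

(** From - (n-2) u <= r u' <= 0: orbits stay in a cone, so W alone controls the pair (W, Z). *)
Lemma Rabs_EF_Z_le (n theta : R) (u v w : R -> R) (r : R) :
  n > 2 -> 0 < theta -> superharmonic n u v w -> 0 < r ->
  Rabs (EF_Z theta u v r) <= (theta + (n - 2)) * EF_W theta u r.
Proof.
  intros Hn Hth H Hr. unfold EF_Z.
  assert (Hv := superharmonic_derive_nonpos n u v w r Hn H Hr).
  assert (Hh := superharmonic_scaled_derive_ge n u v w r Hn H Hr).
  destruct (H r Hr) as (_ & _ & Hu & _).
  unfold EF_W. pose proof (Rpower_pos r theta) as HX.
  assert (H1 : - (Rpower r theta * ((n - 2) * u r)) <= Rpower r theta * (r * v r) <= 0).
  { split; [|assert (r * v r <= 0) by nra; nra]. rewrite Ropp_mult_distr_r. apply Rmult_le_compat_l; lra. }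
  assert (0 < theta * (Rpower r theta * u r)) by (repeat apply Rmult_lt_0_compat; lra).
  assert (0 < (n - 2) * (Rpower r theta * u r)) by (repeat apply Rmult_lt_0_compat; lra).
  apply Rabs_le. lra.
Qed.

(* On the scale r = d L^(-1/theta) the solution has not yet left its value L at the origin, up to a factor controlled by d. *)
Lemma EF_entry (n p mu alpha nu k0 Cf theta tau : R) :
  n > 2 -> p > 1 -> mu >= 0 -> alpha > -2 -> nu > -2 -> 0 < k0 -> 0 <= Cf ->
  theta * (p - 1) = 2 + alpha -> 0 < tau ->
  exists d L0, 0 < d /\ 0 < L0 /\
  forall K f u v L R0, R0 <= 1 ->
    (forall s, 0 < s -> 0 < K s) -> (forall s, 0 < s -> 0 <= f s) ->
    (forall s, 0 < s <= R0 -> K s <= 2 * k0 * Rpower s alpha) ->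
    (forall s, 0 < s <= R0 -> f s <= Cf * Rpower s nu) ->
    radial_solution n p mu K f u v -> sup_at_0 u L -> L0 <= L ->
    let r1 := d * Rpower L (- / theta) in
    r1 <= R0 ->
    Rpower (EF_W theta u r1) (p - 1) <= tau /\
    Rabs (EF_Z theta u v r1 - theta * EF_W theta u r1) <= tau * EF_W theta u r1 /\
    Rpower d theta / 2 <= EF_W theta u r1.
Proof.
  intros Hn Hp Hmu Ha Hnu Hk HCf Hth Htau.
  assert (Hth0 : 0 < theta) by nra.
  (* The integrated K and f terms will each be at most m L: a total of 2 m L <= L / 2 gives u r1 >=
     L / 2, and 2 m L <= tau L / 2 bounds r1 u'. *)
  set (m := Rmin (1 / 4) (tau / 4)).
  assert (Hm : 0 < m) by (apply Rmin_glb_lt; lra).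
  assert (Hm1 : m <= 1 / 4) by apply Rmin_l. assert (Hm2 : m <= tau / 4) by apply Rmin_r.
  assert (Hi1 : 0 < / (n + alpha)) by (apply Rinv_0_lt_compat; lra).
  assert (Hi2 : 0 < / (2 + alpha)) by (apply Rinv_0_lt_compat; lra).
  assert (Hi3 : 0 < / (n + nu)) by (apply Rinv_0_lt_compat; lra).
  assert (Hi4 : 0 < / (2 + nu)) by (apply Rinv_0_lt_compat; lra).
  assert (Hi12 : 0 < / (n + alpha) * / (2 + alpha)) by (apply Rmult_lt_0_compat; lra).
  assert (Hi34 : 0 < / (n + nu) * / (2 + nu)) by (apply Rmult_lt_0_compat; lra).
  (* e1 and e2 dominate the coefficients of both the first and the second integration. *)
  set (e1 := / (n + alpha) + / (n + alpha) * / (2 + alpha)).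
  set (e2 := / (n + nu) + / (n + nu) * / (2 + nu)).
  assert (He1 : 0 < e1) by (unfold e1; lra). assert (He2 : 0 < e2) by (unfold e2; lra).
  destruct (Rpower_small (2 + alpha) (Rmin tau (m / (2 * k0 * e1)))) as (d & Hd & Hsmall);
    [lra| |].
  { apply Rmin_glb_lt; [lra|]. apply Rdiv_lt_0_compat; [lra|]. nra. }
  specialize (Hsmall d ltac:(lra)).
  assert (Hd1 : Rpower d (2 + alpha) <= tau) by (eapply Rle_trans; [exact Hsmall|apply Rmin_l]).
  assert (Hd2 : 2 * k0 * e1 * Rpower d (2 + alpha) <= m).
  { apply Rle_trans with (2 * k0 * e1 * (m / (2 * k0 * e1))).
    - apply Rmult_le_compat_l; [nra|]. eapply Rle_trans; [exact Hsmall|apply Rmin_r].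
    - apply Req_le. field. lra. }
  assert (HB : 0 <= mu * Cf) by nra.
  (* The K term is scale invariant and is made small by d; the f term is only bounded, and is made
     small relative to L by taking L large. *)
  exists d, (mu * Cf * e2 / m + 1). split; [exact Hd|]. split.
  { assert (0 <= mu * Cf * e2 / m); [|lra]. apply Rdiv_le_0_compat; [nra|lra]. }
  intros K f u v L R0 HR0 HK Hf HKu Hfu Hsol [HL Hlim] HLL r1 Hr1.
  assert (HL0 : mu * Cf * e2 <= m * L).
  { apply Rle_trans with (m * (mu * Cf * e2 / m)); [apply Req_le; field; lra|].
    apply Rmult_le_compat_l; lra. }
  assert (HLpos : 0 < L).
  { destruct (Hsol 1 Rlt_0_1) as (_ & _ & H1). specialize (HL 1 Rlt_0_1). lra. }
  assert (HX0 : 0 < Rpower L (- / theta)) by apply Rpower_pos.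
  assert (Hr1p : 0 < r1) by (apply Rmult_lt_0_compat; assumption).
  assert (Hs := radial_superharmonic n p mu K f u v Hmu HK Hf Hsol).
  set (A := 2 * k0 * Rpower L p).
  assert (HA : 0 < A) by (repeat apply Rmult_lt_0_compat; try lra; apply Rpower_pos).
  assert (Hacc : forall s, 0 < s <= R0 ->
     - (A * Rpower s alpha + mu * Cf * Rpower s nu)
     <= accel n p mu K f u v s + (n - 1) / s * v s).
  { intros s Hss. unfold accel.
    assert (K s * Rpower (u s) p <= (2 * k0 * Rpower s alpha) * Rpower L p).
    { apply Rmult_le_compat; [apply Rlt_le, HK; lra|apply Rlt_le, Rpower_pos|apply HKu, Hss|].
      apply Rle_Rpower_l; [lra|]. split; [apply Hsol; lra | apply HL; lra]. }
    assert (mu * f s <= mu * (Cf * Rpower s nu)) by (apply Rmult_le_compat_l; [lra|apply Hfu, Hss]).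
    unfold A. lra. }
  assert (Hv := derive_lower_bound n alpha nu A (mu * Cf) L R0 u v _ r1
                  Hn Ha Hnu (Rlt_le _ _ HA) HB Hs HL Hacc ltac:(lra)).
  assert (Hu := value_lower_bound n alpha nu A (mu * Cf) L R0 u v _ r1
                  Hn Ha Hnu (Rlt_le _ _ HA) HB Hs HL Hlim Hacc ltac:(lra)).
  (* Scale invariance: r1^(2+alpha) L^(p-1) = d^(2+alpha) because theta (p - 1) = 2 + alpha. *)
  assert (HAr : A * Rpower r1 (2 + alpha) = 2 * k0 * Rpower d (2 + alpha) * L).
  { unfold A, r1. rewrite <- Rpower_mult_distr, Rpower_mult by assumption.
    rewrite <- Hth. replace (- / theta * (theta * (p - 1))) with (1 + - p) by (field; lra).
    rewrite (Rpower_plus 1 (- p)), Rpower_1, Rpower_Ropp by exact HLpos.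
    pose proof (Rpower_pos L p). field. lra. }
  assert (HBr : mu * Cf * Rpower r1 (2 + nu) <= mu * Cf).
  { assert (Rpower r1 (2 + nu) <= Rpower 1 (2 + nu)) by (apply Rle_Rpower_l; lra).
    rewrite Rpower_base_1 in H. nra. }
  assert (HB0 : 0 <= mu * Cf * Rpower r1 (2 + nu))
    by (apply Rmult_le_pos; [exact HB|apply Rlt_le, Rpower_pos]).
  assert (HA0 : 0 < A * Rpower r1 (2 + alpha)) by (apply Rmult_lt_0_compat; [exact HA|apply Rpower_pos]).
  set (a1 := A * Rpower r1 (2 + alpha)) in *. set (b1 := mu * Cf * Rpower r1 (2 + nu)) in *.
  assert (Hsum : e1 * a1 + e2 * b1 <= 2 * m * L).
  { assert (e1 * a1 <= m * L) by (rewrite HAr; nra).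
    assert (e2 * b1 <= e2 * (mu * Cf)) by (apply Rmult_le_compat_l; lra). lra. }
  replace (A / (n + alpha) * Rpower r1 (2 + alpha) + mu * Cf / (n + nu) * Rpower r1 (2 + nu))
    with (/ (n + alpha) * a1 + / (n + nu) * b1) in Hv by (unfold a1, b1, Rdiv; ring).
  replace (A / (n + alpha) / (2 + alpha) * Rpower r1 (2 + alpha)
           + mu * Cf / (n + nu) / (2 + nu) * Rpower r1 (2 + nu))
    with (/ (n + alpha) * / (2 + alpha) * a1 + / (n + nu) * / (2 + nu) * b1) in Hu
    by (unfold a1, b1, Rdiv; ring).
  assert (0 <= / (n + alpha) * a1) by (apply Rmult_le_pos; lra).
  assert (0 <= / (n + nu) * b1) by (apply Rmult_le_pos; lra).
  assert (0 <= / (n + alpha) * / (2 + alpha) * a1) by (apply Rmult_le_pos; lra).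
  assert (0 <= / (n + nu) * / (2 + nu) * b1) by (apply Rmult_le_pos; lra).
  unfold e1, e2 in Hsum.
  assert (HuL : L / 2 <= u r1) by nra.
  assert (HvL : - (tau / 2 * L) <= r1 * v r1) by nra.
  assert (Hvn := superharmonic_derive_nonpos n u v _ r1 Hn Hs Hr1p).
  assert (Hr1th : Rpower r1 theta * L = Rpower d theta).
  { unfold r1. rewrite <- Rpower_mult_distr, Rpower_mult by assumption.
    replace (- / theta * theta) with (- (1)) by (field; lra).
    rewrite Rpower_Ropp, Rpower_1 by exact HLpos. field. lra. }
  assert (Hrt := Rpower_pos r1 theta).
  assert (HWle : EF_W theta u r1 <= Rpower d theta).
  { unfold EF_W. rewrite <- Hr1th. apply Rmult_le_compat_l; [lra|]. apply HL, Hr1p. }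
  assert (HWge : Rpower d theta / 2 <= EF_W theta u r1).
  { unfold EF_W. rewrite <- Hr1th. nra. }
  pose proof (Rpower_pos d theta).
  repeat split; [| |exact HWge].
  - apply Rle_trans with (Rpower (Rpower d theta) (p - 1)).
    + apply Rle_Rpower_l; lra.
    + rewrite Rpower_mult, Hth. exact Hd1.
  - replace (EF_Z theta u v r1 - theta * EF_W theta u r1)
      with (Rpower r1 theta * (r1 * v r1)) by (unfold EF_Z; ring).
    apply Rle_trans with (Rpower r1 theta * (tau / 2 * L)).
    + rewrite Rabs_mult, (Rabs_pos_eq (Rpower r1 theta)) by lra.
      apply Rmult_le_compat_l; [lra|]. apply Rabs_le. nra.
    + replace (Rpower r1 theta * (tau / 2 * L)) with (tau * ((Rpower r1 theta * L) / 2)) by field.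
      rewrite Hr1th. apply Rmult_le_compat_l; lra.
Qed.

(** The constants are chosen in the order C, eta, tau, d, delta, s, eps, r0, none depending on L.
    Since r0 comes after d, [EF_entry] has to provide d before its radius [R0] is fixed. The bound C
    comes from [scaled_upper_bound] and the bound m from [lyap_trapping] followed by
    [lyap_lower]. *)
Lemma uniform_bounds_near_0 (n p mu alpha nu k0 theta : R) (K f : R -> R) :
  n > 2 -> p > 1 -> mu >= 0 -> K0_hyp K alpha k0 -> F0_hyp f nu ->
  theta * (p - 1) = 2 + alpha -> 0 < n - 2 - 2 * theta ->
  exists r0 m C d L0, 0 < r0 /\ 0 < m /\ 0 < C /\ 0 < d /\
  forall u v L, radial_solution n p mu K f u v -> sup_at_0 u L -> L0 <= L ->
    (forall r, 0 < r <= r0 -> Rpower r theta * u r <= C) /\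
    (forall r, d * Rpower L (- / theta) <= r <= r0 -> m <= Rpower r theta * u r).
Proof.
  intros Hn Hp Hmu HK HF Hth Ha0.
  assert (HK' := HK). destruct HK' as (_ & HKpos & Hal & Hk & _).
  assert (HF' := HF). destruct HF' as (_ & Hfpos & _ & Hnu & _).
  assert (Hth0 : 0 < theta) by nra.
  set (a := n - 2 - 2 * theta) in *. set (b := theta * (theta + a)).
  assert (Hb : 0 < b) by (apply Rmult_lt_0_compat; lra).
  destruct (K0_near K alpha k0 (k0 / 2) HK) as (R1 & HR1 & HK1); [lra|].
  destruct (F0_near f nu HF) as (Cf & R2 & HCf & HR2 & Hf2).
  set (C := Rpower ((n + alpha) * (2 + alpha) / (k0 / 2 * (p - 1))) (/ (p - 1))).
  assert (HC : 0 < C) by apply Rpower_pos.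
  set (H := theta + (n - 2)). assert (HH : 0 < H) by (unfold H; lra).
  set (Qm := Rpower C (p - 1)). assert (HQm : 0 < Qm) by apply Rpower_pos.
  assert (HQ : forall w, 0 < w <= C -> Rpower w (p - 1) <= Qm)
    by (intros w Hw; apply Rle_Rpower_l; lra).
  set (G1 := b + k0 * p * Qm).
  assert (HG1 : 0 < G1).
  { unfold G1. assert (0 < k0 * p * Qm) by (repeat apply Rmult_lt_0_compat; lra). lra. }
  set (Gm := (b + k0 * Qm) * C).
  assert (HkQm : 0 < k0 * Qm) by (apply Rmult_lt_0_compat; lra).
  assert (HGm : 0 < Gm) by (apply Rmult_lt_0_compat; lra).
  set (eta := Rmin (1 / 2) (Rmin (a / (4 * G1)) (1 / (2 * a)))).
  assert (0 < a / (4 * G1)) by (apply Rdiv_lt_0_compat; lra).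
  assert (0 < 1 / (2 * a)) by (apply Rdiv_lt_0_compat; lra).
  assert (Heta : 0 < eta <= 1 / 2).
  { split; [repeat apply Rmin_glb_lt; lra | apply Rmin_l]. }
  assert (Heta1 : eta * G1 <= a / 4).
  { apply Rle_trans with (a / (4 * G1) * G1); [|apply Req_le; field; lra].
    apply Rmult_le_compat_r; [lra|]. eapply Rle_trans; [apply Rmin_r|apply Rmin_l]. }
  assert (Heta2 : 2 * a * eta <= 1).
  { apply Rle_trans with (2 * a * (1 / (2 * a))); [|apply Req_le; field; lra].
    apply Rmult_le_compat_l; [lra|]. eapply Rle_trans; [apply Rmin_r|apply Rmin_r]. }
  destruct (lyap_entry a theta k0 p eta) as (tau & Htau & Hentry); try lra.
  fold b in Hentry.
  destruct (lyap_level_gap b k0 p C eta) as (delta0 & Hdelta0 & Hgap); try lra.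
  destruct (EF_entry n p mu alpha nu k0 Cf theta tau) as (d & L0 & Hd & HL0 & Hstart);
    try assumption; try lra.
  (* The depth guaranteed at entry by [lyap_entry], with W >= d^theta / 2 there. *)
  set (delta1 := theta * a / 4 * (Rpower d theta / 2) ^ 2).
  assert (Hta : 0 < theta * a) by (apply Rmult_lt_0_compat; lra).
  assert (Hdelta1 : 0 < delta1).
  { apply Rmult_lt_0_compat; [lra|]. apply pow_lt. pose proof (Rpower_pos d theta). lra. }
  set (delta := Rmin delta0 delta1).
  assert (Hdelta : 0 < delta) by (apply Rmin_glb_lt; assumption).
  destruct (Hgap delta) as (s & Hs & Hgaps); [split; [exact Hdelta|apply Rmin_l]|].
  set (c := Rmin (a / 2) (eta / 2)).
  assert (Hc : 0 < c) by (apply Rmin_glb_lt; lra).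
  assert (HHC : 0 < H * C + Gm) by (assert (0 < H * C) by nra; lra).
  set (eps := c * s ^ 2 / (2 * (H * C + Gm))).
  assert (Hcs : 0 < c * s ^ 2) by (apply Rmult_lt_0_compat; [lra|apply pow_lt; lra]).
  assert (Heps : 0 < eps) by (apply Rdiv_lt_0_compat; lra).
  assert (Heps1 : (H * C + Gm) * eps < c * s ^ 2).
  { replace ((H * C + Gm) * eps) with (c * s ^ 2 / 2) by (unfold eps; field; lra). lra. }
  assert (HQmC : 0 < Qm * C) by (apply Rmult_lt_0_compat; lra).
  destruct (K0_near K alpha k0 (eps / (2 * (Qm * C))) HK) as (R3 & HR3 & HK3).
  { apply Rdiv_lt_0_compat; lra. }
  assert (HB : 0 <= mu * Cf) by nra.
  destruct (Rpower_small (2 + nu) (eps / (2 * (mu * Cf + 1)))) as (R4 & HR4 & Hr4); [lra| |].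
  { apply Rdiv_lt_0_compat; lra. }
  (* R1 and R2 make K comparable to k0 r^alpha and f at most Cf r^nu; R3 and R4 hold each of the two
     parts of [EF_P] below eps / 2. *)
  set (r0 := Rmin 1 (Rmin (Rmin R1 R2) (Rmin R3 R4))).
  assert (Hr0 : 0 < r0) by (repeat apply Rmin_glb_lt; lra).
  assert (Hr01 : r0 <= 1) by apply Rmin_l.
  assert (Hr02 : r0 <= R1) by (eapply Rle_trans; [apply Rmin_r|];
    eapply Rle_trans; [apply Rmin_l|]; apply Rmin_l).
  assert (Hr03 : r0 <= R2) by (eapply Rle_trans; [apply Rmin_r|];
    eapply Rle_trans; [apply Rmin_l|]; apply Rmin_r).
  assert (Hr04 : r0 <= R3) by (eapply Rle_trans; [apply Rmin_r|];
    eapply Rle_trans; [apply Rmin_r|]; apply Rmin_l).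
  assert (Hr05 : r0 <= R4) by (eapply Rle_trans; [apply Rmin_r|];
    eapply Rle_trans; [apply Rmin_r|]; apply Rmin_r).
  set (Lam := b / 2 + eta * H * (b + k0 * Qm)).
  assert (HLam : 0 < Lam).
  { unfold Lam. assert (0 < eta * H * (b + k0 * Qm)) by (repeat apply Rmult_lt_0_compat; lra). lra. }
  assert (HdL : 0 < delta / Lam) by (apply Rdiv_lt_0_compat; lra).
  (* Lam W^2 >= delta would give a square root; the cap 1 avoids it, since W < 1 implies W^2 <=
     W. *)
  exists r0, (Rmin 1 (delta / Lam)), C, d, L0.
  split; [exact Hr0|]. split; [apply Rmin_glb_lt; lra|]. split; [exact HC|]. split; [exact Hd|].
  intros u v L Hsol Hsup HL.
  assert (Hsh := radial_superharmonic n p mu K f u v Hmu HKpos Hfpos Hsol).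
  assert (HKb : forall s, 0 < s <= r0 ->
    k0 / 2 * Rpower s alpha <= K s <= 2 * k0 * Rpower s alpha).
  { intros x Hx. specialize (HK1 x ltac:(lra)). apply Rabs_le_between in HK1.
    pose proof (Rpower_pos x alpha) as Hxa.
    replace (K x) with (K x / Rpower x alpha * Rpower x alpha) by (field; lra).
    split; apply Rmult_le_compat_r; lra. }
  assert (Hup : forall r, 0 < r <= r0 -> EF_W theta u r <= C).
  { intros r Hr. unfold EF_W, C.
    replace theta with ((2 + alpha) / (p - 1)) by (rewrite <- Hth; field; lra).
    apply (scaled_upper_bound n p alpha (k0 / 2) r0 u v (accel n p mu K f u v));
      try assumption; try lra.
    intros x Hx. unfold accel. specialize (HKb x Hx).
    assert (Hfx := Hfpos x ltac:(lra)). pose proof (Rpower_pos (u x) p).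
    assert (0 <= mu * f x) by (apply Rmult_le_pos; lra).
    assert (k0 / 2 * Rpower x alpha * Rpower (u x) p <= K x * Rpower (u x) p)
      by (apply Rmult_le_compat_r; lra).
    lra. }
  split; [exact Hup|]. intros r Hr.
  set (r1 := d * Rpower L (- / theta)) in *.
  assert (Hr1 : 0 < r1) by (apply Rmult_lt_0_compat; [exact Hd|apply Rpower_pos]).
  destruct (Hstart K f u v L r0) as (HQ1 & HZ1 & HW1); trivial.
  { intros x Hx. apply HKb, Hx. }
  { intros x Hx. apply Hf2; lra. }
  { fold r1. lra. }
  fold r1 in HQ1, HZ1, HW1.
  assert (HWpos : forall x, 0 < x -> 0 < EF_W theta u x).
  { intros x Hx. apply Rmult_lt_0_compat; [apply Rpower_pos|]. apply Hsol, Hx. }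
  assert (HV : lyap b k0 p eta (EF_W theta u r) (EF_Z theta u v r) <= - delta).
  { apply (lyap_trapping a b k0 p C H eta G1 Gm eps delta s r1 r
      (EF_W theta u) (EF_Z theta u v) (EF_P p mu alpha k0 theta K f u));
      try assumption; try lra.
    - intros w Hw. unfold force, Gm. specialize (HQ w Hw).
      pose proof (Rpower_pos w (p - 1)).
      apply Rle_trans with ((b + k0 * Qm) * w); [|apply Rmult_le_compat_l; lra].
      assert (0 < k0 * Rpower w (p - 1) * w) by (repeat apply Rmult_lt_0_compat; lra).
      assert (k0 * Rpower w (p - 1) * w <= k0 * Qm * w)
        by (apply Rmult_le_compat_r; [lra|apply Rmult_le_compat_l; lra]).
      assert (0 < b * w) by (apply Rmult_lt_0_compat; lra).
      apply Rabs_le. lra.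
    - intros w Hw. unfold G1. specialize (HQ w Hw).
      pose proof (Rpower_pos w (p - 1)).
      assert (0 < k0 * p) by (apply Rmult_lt_0_compat; lra).
      assert (0 < k0 * p * Rpower w (p - 1)) by (apply Rmult_lt_0_compat; lra).
      assert (k0 * p * Rpower w (p - 1) <= k0 * p * Qm) by (apply Rmult_le_compat_l; lra).
      apply Rabs_le. lra.
    - intros x Hx. assert (Hx0 : 0 < x) by lra.
      assert (HWx : 0 < EF_W theta u x <= C) by (split; [apply HWpos; lra | apply Hup; lra]).
      split; [exact HWx|]. split; [apply (Rabs_EF_Z_le n theta u v _ x Hn Hth0 Hsh Hx0)|].
      split; [|split].
      + unfold EF_P. eapply Rle_trans; [apply Rabs_triang|].
        replace eps with (eps / (2 * (Qm * C)) * (Qm * C) + eps / 2) by (field; lra).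
        apply Rplus_le_compat.
        * rewrite Rabs_mult. apply Rmult_le_compat; try apply Rabs_pos.
          -- apply HK3; lra.
          -- specialize (HQ _ HWx). pose proof (Rpower_pos (EF_W theta u x) (p - 1)).
             rewrite Rabs_pos_eq by (apply Rmult_le_pos; lra).
             apply Rmult_le_compat; lra.
        * pose proof (Hfpos x Hx0) as Hfx. pose proof (Rpower_pos x (2 + theta)).
          pose proof (Hf2 x ltac:(lra)) as Hfx2.
          rewrite Rabs_pos_eq by (apply Rmult_le_pos; [lra|apply Rmult_le_pos; lra]).
          apply Rle_trans with (mu * (Rpower x (2 + theta) * (Cf * Rpower x nu))).
          { apply Rmult_le_compat_l; [lra|]. apply Rmult_le_compat_l; lra. }
          replace (mu * (Rpower x (2 + theta) * (Cf * Rpower x nu)))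
            with (mu * Cf * (Rpower x theta * Rpower x (2 + nu)))
            by (rewrite !(Rpower_plus 2); ring).
          assert (Hxt : Rpower x theta <= 1).
          { rewrite <- (Rpower_base_1 theta). apply Rle_Rpower_l; lra. }
          assert (Hxn := Hr4 x ltac:(lra)).
          pose proof (Rpower_pos x theta). pose proof (Rpower_pos x (2 + nu)).
          assert (Hprod : Rpower x theta * Rpower x (2 + nu) <= eps / (2 * (mu * Cf + 1))) by nra.
          apply Rle_trans with (mu * Cf * (eps / (2 * (mu * Cf + 1)))).
          { apply Rmult_le_compat_l; assumption. }
          apply (Rmult_le_reg_r (2 * (mu * Cf + 1))); [lra|].
          replace (mu * Cf * (eps / (2 * (mu * Cf + 1))) * (2 * (mu * Cf + 1)))
            with (mu * Cf * eps) by (field; lra). nra.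
      + apply (is_derive_EF_W n p mu theta K f u v x Hsol Hx0).
      + apply (is_derive_EF_Z n p mu alpha k0 theta K f u v x Hth Hsol Hx0).
    - eapply Rle_trans; [apply Hentry; [apply HWpos; lra|exact HQ1|exact HZ1]|].
      assert (delta <= delta1) by apply Rmin_r.
      assert ((Rpower d theta / 2) ^ 2 <= EF_W theta u r1 ^ 2).
      { apply pow_incr. pose proof (Rpower_pos d theta). lra. }
      assert (theta * a / 4 * (Rpower d theta / 2) ^ 2 <= theta * a / 4 * EF_W theta u r1 ^ 2)
        by (apply Rmult_le_compat_l; lra).
      unfold delta1 in *. lra. }
  assert (HWr := HWpos r ltac:(lra)).
  assert (Hlow := lyap_lower b k0 p eta H Qm (EF_W theta u r) (EF_Z theta u v r)
    Hb Hk Hp (proj1 Heta) HWr (Rlt_le _ _ HH)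
    (Rabs_EF_Z_le n theta u v _ r Hn Hth0 Hsh ltac:(lra))
    (HQ _ (conj HWr (Hup r ltac:(lra))))).
  fold Lam in Hlow. fold (EF_W theta u r).
  apply Rnot_lt_le; intros Hlt.
  assert (Hlt1 : EF_W theta u r < 1) by (eapply Rlt_le_trans; [exact Hlt|apply Rmin_l]).
  assert (Hlt2 : EF_W theta u r < delta / Lam) by (eapply Rlt_le_trans; [exact Hlt|apply Rmin_r]).
  apply (Rmult_lt_compat_l Lam) in Hlt2; [|exact HLam].
  replace (Lam * (delta / Lam)) with delta in Hlt2 by (field; lra).
  assert (EF_W theta u r ^ 2 <= EF_W theta u r) by nra.
  assert (Lam * EF_W theta u r ^ 2 <= Lam * EF_W theta u r) by (apply Rmult_le_compat_l; lra).
  lra.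
Qed.

(** * Compactness *)

(** phi need not be increasing: k <= phi k is enough to preserve limits and properties that hold
    eventually. *)
Lemma bounded_subsequence (x : nat -> R) (M : R) :
  (forall j, Rabs (x j) <= M) ->
  exists (phi : nat -> nat) (l : R),
    (forall k, (k <= phi k)%nat) /\ is_lim_seq (fun k => x (phi k)) l.
Proof.
  intros HM.
  destruct (Bolzano_Weierstrass x (fun c => - M <= c <= M)) as [l Hl].
  { apply compact_P3. }
  { intros j. apply Rabs_le_between, HM. }
  assert (Hex : forall k, exists q, (k <= q)%nat /\ Rabs (x q - l) < / (INR k + 1)).
  { intros k.
    assert (Hk : 0 < / (INR k + 1)) by (apply Rinv_0_lt_compat; pose proof (pos_INR k); lra).
    apply (Hl (fun y => Rabs (y - l) < / (INR k + 1)) k).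
    exists (mkposreal _ Hk). intros y Hy. exact Hy. }
  apply functional_choice in Hex. destruct Hex as [phi Hphi].
  exists phi, l. split; [intros k; apply Hphi|].
  apply is_lim_seq_spec. intros eps.
  destruct (archimed_cor1 eps (cond_pos eps)) as (N & HN & HN0).
  exists N. intros k Hk. destruct (Hphi k) as [_ Hlt].
  eapply Rlt_trans; [exact Hlt|]. eapply Rle_lt_trans; [|exact HN].
  apply Rinv_le_contravar; [apply lt_0_INR; lia|].
  apply le_INR in Hk. lra.
Qed.

Lemma subsequence_tendsto (x : nat -> R) (l : R) (phi : nat -> nat) :
  (forall k, (k <= phi k)%nat) -> is_lim_seq x l -> is_lim_seq (fun k => x (phi k)) l.
Proof.
  intros Hphi Hx. apply is_lim_seq_spec in Hx. apply is_lim_seq_spec.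
  intros eps. destruct (Hx eps) as [N HN]. exists N. intros k Hk.
  apply HN. specialize (Hphi k). lia.
Qed.

Lemma Rpower_lipschitz (p c C : R) :
  p > 1 -> 0 < c <= C ->
  exists Lp, 0 <= Lp /\ forall x y, c <= x <= C -> c <= y <= C ->
    Rabs (Rpower x p - Rpower y p) <= Lp * Rabs (x - y).
Proof.
  intros Hp Hc. exists (p * Rpower C p / c).
  assert (HL : 0 <= p * Rpower C p / c).
  { apply Rdiv_le_0_compat; [|lra]. pose proof (Rpower_pos C p). nra. }
  split; [exact HL|]. intros x y Hx Hy.
  destruct (MVT_gen (fun s => Rpower s p) y x (fun s => p * Rpower s p / s)) as (z & Hz & Heq).
  - intros s Hs. apply is_derive_Rpower.
    pose proof (Rmin_glb y x c ltac:(lra) ltac:(lra)). lra.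
  - intros s Hs. apply continuity_pt_filterlim.
    apply (is_derive_continuous (fun s => Rpower s p) s (p * Rpower s p / s)). apply is_derive_Rpower.
    pose proof (Rmin_glb y x c ltac:(lra) ltac:(lra)). lra.
  - assert (Hzc : c <= z <= C).
    { pose proof (Rmin_glb y x c ltac:(lra) ltac:(lra)).
      pose proof (Rmax_lub y x C ltac:(lra) ltac:(lra)). lra. }
    rewrite Heq, Rabs_mult. apply Rmult_le_compat_r; [apply Rabs_pos|].
    pose proof (Rpower_pos z p).
    rewrite Rabs_pos_eq by (apply Rdiv_le_0_compat; nra).
    unfold Rdiv. apply Rmult_le_compat; [nra| | |].
    + apply Rlt_le, Rinv_0_lt_compat; lra.
    + apply Rmult_le_compat_l; [lra|]. apply Rle_Rpower_l; lra.
    + apply Rinv_le_contravar; lra.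
Qed.

Lemma continuous_bounded (g : R -> R) (a b : R) :
  a <= b -> (forall x, a <= x <= b -> continuous g x) ->
  exists M, 0 <= M /\ forall x, a <= x <= b -> g x <= M.
Proof.
  intros Hab Hc.
  destruct (continuity_ab_maj g a b Hab) as (z & Hz & _).
  { intros x Hx. apply continuity_pt_filterlim, Hc, Hx. }
  exists (Rabs (g z)). split; [apply Rabs_pos|].
  intros x Hx. eapply Rle_trans; [apply Hz, Hx|apply Rle_abs].
Qed.

(** Gronwall in both directions from x0: exp(- La s) g is nonincreasing and exp(La s) g
    nondecreasing. *)
Lemma exponential_growth_bound (g dg : R -> R) (La a b x0 x : R) :
  0 <= La -> a <= x0 <= b -> a <= x <= b ->
  (forall y, a <= y <= b -> is_derive g y (dg y) /\ 0 <= g y /\ Rabs (dg y) <= La * g y) ->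
  g x <= exp (La * (b - a)) * g x0.
Proof.
  intros HLa Hx0 Hx H.
  assert (Hg0 : 0 <= g x0) by (apply H; exact Hx0).
  assert (Hexp : forall t, t <= b - a -> exp (La * t) * g x0 <= exp (La * (b - a)) * g x0).
  { intros t Ht. apply Rmult_le_compat_r; [exact Hg0|].
    destruct (Req_dec (La * t) (La * (b - a))) as [->|Hne]; [lra|].
    apply Rlt_le, exp_increasing. nra. }
  assert (Hd : forall (k y : R), a <= y <= b ->
    is_derive (fun s => exp (k * s) * g s) y (exp (k * y) * (k * g y + dg y))).
  { intros k y Hy. evar_last.
    { apply (is_derive_mult (fun s => exp (k * s)) g); [|apply H, Hy|intros; apply Rmult_comm].
      apply (is_derive_comp exp (fun s => k * s)); [apply is_derive_exp|].
      apply (is_derive_scal (fun s => s)). apply (is_derive_id (K := R_AbsRing)). }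
    unfold plus, mult, scal, one; simpl. unfold mult; simpl. ring. }
  destruct (Rle_dec x0 x) as [Hle|Hgt].
  - eapply Rle_trans; [|apply (Hexp (x - x0)); lra].
    assert (Hm : exp (- La * x) * g x <= exp (- La * x0) * g x0).
    { apply (nonincreasing_of_derive (fun s => exp (- La * s) * g s)
        (fun y => exp (- La * y) * (- La * g y + dg y))); [exact Hle| |].
      - intros y Hy. apply Hd. lra.
      - intros y Hy. destruct (H y) as (_ & _ & Hb); [lra|].
        pose proof (exp_pos (- La * y)). pose proof (Rle_abs (dg y)). nra. }
    apply (Rmult_le_compat_l (exp (La * x))) in Hm; [|apply Rlt_le, exp_pos].
    rewrite <- !Rmult_assoc, <- !exp_plus in Hm.
    replace (La * x + - La * x) with 0 in Hm by ring.
    replace (La * x + - La * x0) with (La * (x - x0)) in Hm by ring.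
    rewrite exp_0 in Hm. lra.
  - eapply Rle_trans; [|apply (Hexp (x0 - x)); lra].
    assert (Hm : exp (La * x) * g x <= exp (La * x0) * g x0).
    { apply (nondecreasing_of_derive (fun s => exp (La * s) * g s)
        (fun y => exp (La * y) * (La * g y + dg y))); [lra| |].
      - intros y Hy. apply Hd. lra.
      - intros y Hy. destruct (H y) as (_ & _ & Hb); [lra|].
        pose proof (exp_pos (La * y)). pose proof (Rle_abs (- dg y)) as Hn.
        rewrite Rabs_Ropp in Hn. apply Rmult_le_pos; lra. }
    apply (Rmult_le_compat_l (exp (- La * x))) in Hm; [|apply Rlt_le, exp_pos].
    rewrite <- !Rmult_assoc, <- !exp_plus in Hm.
    replace (- La * x + La * x) with 0 in Hm by ring.
    replace (- La * x + La * x0) with (La * (x0 - x)) in Hm by ring.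
    rewrite exp_0 in Hm. lra.
Qed.

Lemma accel_lipschitz (n p mu : R) (K f : R -> R) (a b c C : R) :
  n > 2 -> p > 1 -> 0 < a <= b -> 0 < c <= C ->
  (forall r, 0 < r -> continuous K r) -> (forall r, 0 < r -> 0 < K r) ->
  exists Lu Lv, 0 <= Lu /\ 0 <= Lv /\
  forall u v u' v' r, a <= r <= b -> c <= u r <= C -> c <= u' r <= C ->
    Rabs (accel n p mu K f u v r - accel n p mu K f u' v' r)
      <= Lu * Rabs (u r - u' r) + Lv * Rabs (v r - v' r).
Proof.
  intros Hn Hp Hab Hc HKc HK.
  destruct (Rpower_lipschitz p c C Hp Hc) as (Lp & HLp & HLip).
  destruct (continuous_bounded K a b) as (M & HM & HMb); [lra| |].
  { intros x Hx. apply HKc. lra. }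
  exists (M * Lp), ((n - 1) / a).
  split; [apply Rmult_le_pos; assumption|]. split; [apply Rdiv_le_0_compat; lra|].
  intros u v u' v' r Hr Hu Hu'. unfold accel.
  replace (- ((n - 1) / r * v r) - K r * Rpower (u r) p - mu * f r
           - (- ((n - 1) / r * v' r) - K r * Rpower (u' r) p - mu * f r))
    with (- (K r * (Rpower (u r) p - Rpower (u' r) p)) + - ((n - 1) / r * (v r - v' r))) by ring.
  eapply Rle_trans; [apply Rabs_triang|]. rewrite !Rabs_Ropp, !Rabs_mult.
  specialize (HK r ltac:(lra)). rewrite (Rabs_pos_eq (K r)) by lra.
  rewrite (Rabs_pos_eq ((n - 1) / r)) by (apply Rdiv_le_0_compat; lra).
  apply Rplus_le_compat.
  - rewrite Rmult_assoc. apply Rmult_le_compat; [lra|apply Rabs_pos|apply HMb, Hr|].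
    apply HLip; assumption.
  - apply Rmult_le_compat_r; [apply Rabs_pos|]. unfold Rdiv.
    apply Rmult_le_compat_l; [lra|]. apply Rinv_le_contravar; lra.
Qed.

(** Convergence of the data at the single radius r1 becomes uniform convergence on [a, b], which
    makes an equicontinuity argument unnecessary. The squared distance is used because it is
    differentiable also where the solutions meet. *)
Lemma solutions_distance_bound (n p mu : R) (K f : R -> R) (a b c C r1 : R) :
  n > 2 -> p > 1 -> 0 < a <= b -> 0 < c <= C -> a <= r1 <= b ->
  (forall r, 0 < r -> continuous K r) -> (forall r, 0 < r -> 0 < K r) ->
  exists E, 0 < E /\
  forall u v u' v',
    radial_solution n p mu K f u v -> radial_solution n p mu K f u' v' ->
    (forall r, a <= r <= b -> c <= u r <= C) -> (forall r, a <= r <= b -> c <= u' r <= C) ->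
    forall r, a <= r <= b ->
      (u r - u' r) ^ 2 + (v r - v' r) ^ 2 <= E * ((u r1 - u' r1) ^ 2 + (v r1 - v' r1) ^ 2).
Proof.
  intros Hn Hp Hab Hc Hr1 HKc HK.
  destruct (accel_lipschitz n p mu K f a b c C Hn Hp Hab Hc HKc HK)
    as (Lu & Lv & HLu & HLv & Hlip).
  exists (exp ((1 + Lu + 2 * Lv) * (b - a))). split; [apply exp_pos|].
  intros u v u' v' Hs Hs' Hb Hb' r Hr.
  set (w := accel n p mu K f u v). set (w' := accel n p mu K f u' v').
  apply (exponential_growth_bound (fun r => (u r - u' r) ^ 2 + (v r - v' r) ^ 2)
    (fun r => 2 * (u r - u' r) * (v r - v' r) + 2 * (v r - v' r) * (w r - w' r)));
    [lra|exact Hr1|exact Hr|].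
  intros y Hy. destruct (Hs y) as (Hu & Hv & _); [lra|].
  destruct (Hs' y) as (Hu' & Hv' & _); [lra|].
  split; [|split].
  - evar_last.
    { apply (is_derive_plus (fun r => (u r - u' r) ^ 2) (fun r => (v r - v' r) ^ 2)).
      - apply (is_derive_pow (fun r => u r - u' r) 2). apply (is_derive_minus u u'); eassumption.
      - apply (is_derive_pow (fun r => v r - v' r) 2). apply (is_derive_minus v v'); eassumption. }
    unfold plus, minus, opp; simpl. unfold plus; simpl. unfold w, w'. ring.
  - pose proof (pow2_ge_0 (u y - u' y)). pose proof (pow2_ge_0 (v y - v' y)). lra.
  - specialize (Hlip u v u' v' y Hy (Hb y Hy) (Hb' y Hy)). fold w w' in Hlip.
    rewrite <- (pow2_abs (u y - u' y)), <- (pow2_abs (v y - v' y)).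
    eapply Rle_trans; [apply Rabs_triang|]. rewrite !Rabs_mult, (Rabs_pos_eq 2) by lra.
    set (A := Rabs (u y - u' y)) in *. set (B := Rabs (v y - v' y)) in *.
    assert (HA : 0 <= A) by apply Rabs_pos. assert (HB : 0 <= B) by apply Rabs_pos.
    assert (H1 : 2 * A * B <= A ^ 2 + B ^ 2) by (pose proof (pow2_ge_0 (A - B)); lra).
    assert (H2 : 2 * B * Rabs (w y - w' y) <= 2 * B * (Lu * A + Lv * B))
      by (apply Rmult_le_compat_l; lra).
    assert (H3 : Lu * (2 * A * B) <= Lu * (A ^ 2 + B ^ 2)) by (apply Rmult_le_compat_l; lra).
    assert (H4 : 0 <= Lv * A ^ 2) by (apply Rmult_le_pos; nra). nra.
Qed.

(** The limit is named by the total function [Lim_seq], hence does not depend on D; the limits on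
    different compact intervals are one function. *)
Lemma uniform_limit_of_cauchy (x : nat -> R -> R) (D : R -> Prop) :
  (forall eps, 0 < eps -> exists N, forall k l, (N <= k)%nat -> (N <= l)%nat ->
     forall r, D r -> Rabs (x k r - x l r) <= eps) ->
  (forall r, D r -> is_lim_seq (fun k => x k r) (real (Lim_seq (fun k => x k r)))) /\
  (forall eps, 0 < eps -> exists N, forall k, (N <= k)%nat ->
     forall r, D r -> Rabs (real (Lim_seq (fun k => x k r)) - x k r) <= eps).
Proof.
  intros H.
  assert (Hlim : forall r, D r -> is_lim_seq (fun k => x k r) (real (Lim_seq (fun k => x k r)))).
  { intros r Hr. apply Lim_seq_correct'. apply ex_lim_seq_cauchy_corr.
    intros eps. destruct (H (eps / 2)) as [N HN]; [pose proof (cond_pos eps); lra|].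
    exists N. intros k l Hk Hl. specialize (HN k l Hk Hl r Hr).
    pose proof (cond_pos eps). lra. }
  split; [exact Hlim|]. intros eps He. destruct (H eps He) as [N HN]. exists N.
  intros k Hk r Hr.
  apply (is_lim_seq_le_loc (fun l => Rabs (x l r - x k r)) (fun _ => eps)
    (Rabs (real (Lim_seq (fun k => x k r)) - x k r)) eps).
  - exists N. intros l Hl. apply HN; assumption.
  - apply (is_lim_seq_abs (fun l => x l r - x k r)
      (Finite (real (Lim_seq (fun k => x k r)) - x k r))).
    apply is_lim_seq_minus'; [apply Hlim, Hr|apply is_lim_seq_const].
  - apply is_lim_seq_const.
Qed.

Lemma continuous_accel (n p mu : R) (K f u v : R -> R) (r : R) :
  0 < r -> 0 < u r -> continuous K r -> continuous f r ->
  continuous u r -> continuous v r -> continuous (accel n p mu K f u v) r.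
Proof.
  intros Hr Hu HK Hf Hcu Hcv. unfold accel.
  apply (continuous_minus (fun s => - ((n - 1) / s * v s) - K s * Rpower (u s) p)
    (fun s => mu * f s)).
  - apply (continuous_minus (fun s => - ((n - 1) / s * v s)) (fun s => K s * Rpower (u s) p)).
    + apply (continuous_opp (fun s => (n - 1) / s * v s)).
      apply (continuous_mult (fun s => (n - 1) / s) v); [|exact Hcv].
      apply (continuous_mult (fun _ => n - 1) Rinv); [apply continuous_const|].
      apply continuous_Rinv. lra.
    + apply (continuous_mult K (fun s => Rpower (u s) p)); [exact HK|].
      apply (continuous_comp u (fun y => Rpower y p)); [exact Hcu|].
      eapply is_derive_continuous. apply is_derive_Rpower, Hu.
  - apply (continuous_mult (fun _ => mu) f); [apply continuous_const|exact Hf].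
Qed.

Lemma is_derive_uniform_limit (x dx : nat -> R -> R) (g dg : R -> R) (a b r : R) :
  a < r < b ->
  (forall k y, a <= y <= b -> is_derive (x k) y (dx k y)) ->
  (forall y, a <= y <= b -> is_lim_seq (fun k => x k y) (g y)) ->
  (forall eps, 0 < eps -> exists N, forall k, (N <= k)%nat ->
     forall y, a <= y <= b -> Rabs (dg y - dx k y) <= eps) ->
  (forall k y, a <= y <= b -> continuous (dx k) y) ->
  is_derive g r (dg r).
Proof.
  intros Hr Hd Hlim Hunif Hcont.
  assert (Hm : 0 < Rmin (r - a) (b - r)) by (apply Rmin_glb_lt; lra).
  set (m := mkposreal _ Hm).
  assert (HB : forall y, Boule r m y -> a <= y <= b).
  { intros y Hy. unfold Boule in Hy. simpl in Hy. apply Rabs_def2 in Hy.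
    pose proof (Rmin_l (r - a) (b - r)). pose proof (Rmin_r (r - a) (b - r)). lra. }
  assert (HCVU : CVU dx dg r m).
  { intros eps He. destruct (Hunif (eps / 2)) as [N HN]; [lra|].
    exists N. intros k y Hk Hy. specialize (HN k Hk y (HB y Hy)). lra. }
  apply is_derive_Reals.
  apply (derivable_pt_lim_CVU x dx g dg r r m).
  - unfold Boule. rewrite Rminus_diag, Rabs_R0. apply cond_pos.
  - intros y k Hy. apply is_derive_Reals, Hd, HB, Hy.
  - intros y Hy. apply is_lim_seq_Reals, Hlim, HB, Hy.
  - exact HCVU.
  - intros y Hy. apply (CVU_continuity dx dg r m HCVU); [|exact Hy].
    intros k z Hz. apply continuity_pt_filterlim, Hcont, HB, Hz.
Qed.

(** The last conclusion passes lower bounds to the limit one radius at a time, so the index from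
    which they hold may depend on r. *)
Lemma radial_compactness (n p mu : R) (K f : R -> R) (u v : nat -> R -> R) (r1 M : R) :
  n > 2 -> p > 1 -> 0 < r1 ->
  (forall r, 0 < r -> continuous K r) -> (forall r, 0 < r -> 0 < K r) ->
  (forall r, 0 < r -> continuous f r) ->
  (forall j, radial_solution n p mu K f (u j) (v j)) ->
  (forall a b, 0 < a <= b -> exists c C, 0 < c /\
     forall j r, a <= r <= b -> c <= u j r <= C) ->
  (forall j, Rabs (v j r1) <= M) ->
  exists us vs, radial_solution n p mu K f us vs /\
    forall r m, 0 < r -> (exists J, forall j, (J <= j)%nat -> m <= u j r) -> m <= us r.
Proof.
  intros Hn Hp Hr1 HKc HK Hfc Hsol Hbd HM.
  destruct (Hbd r1 r1) as (c1 & C1 & Hc1 & Hu1); [lra|].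
  destruct (bounded_subsequence (fun j => u j r1) C1) as (phi & lu & Hphi & Hlu).
  { intros j. specialize (Hu1 j r1 ltac:(lra)). apply Rabs_le. lra. }
  destruct (bounded_subsequence (fun k => v (phi k) r1) M) as (psi & lv & Hpsi & Hlv).
  { intros k. apply HM. }
  apply (subsequence_tendsto _ lu psi Hpsi) in Hlu. simpl in Hlu.
  set (x := fun k => u (phi (psi k))). set (y := fun k => v (phi (psi k))).
  change (is_lim_seq (fun k => x k r1) lu) in Hlu.
  change (is_lim_seq (fun k => y k r1) lv) in Hlv.
  assert (Hidx : forall k, (k <= phi (psi k))%nat).
  { intros k. specialize (Hpsi k). specialize (Hphi (psi k)). lia. }
  assert (Hxs : forall k, radial_solution n p mu K f (x k) (y k)) by (intros k; apply Hsol).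
  assert (Hcau : forall a b, 0 < a <= b -> a <= r1 <= b ->
    forall eps, 0 < eps -> exists N, forall k l, (N <= k)%nat -> (N <= l)%nat ->
      forall r, a <= r <= b ->
        Rabs (x k r - x l r) <= eps /\ Rabs (y k r - y l r) <= eps).
  { intros a b Hab Har eps He.
    destruct (Hbd a b Hab) as (c & C & Hc & HcC).
    assert (c <= C) by (specialize (HcC 0%nat a ltac:(lra)); lra).
    destruct (solutions_distance_bound n p mu K f a b c C r1) as (E & HE & Hdist);
      try assumption; try lra.
    (* Data within e of their limits differ pairwise by less than 2 e, and (2 e)^2 <= 4 e as e <= 1;
       the two squares times E then add up to at most 8 E e <= eps^2. *)
    set (e := Rmin 1 (eps ^ 2 / (8 * E))).
    assert (He0 : 0 < e).
    { apply Rmin_glb_lt; [lra|]. apply Rdiv_lt_0_compat; [apply pow_lt|]; lra. }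
    assert (He1 : e <= 1) by apply Rmin_l.
    assert (He2 : 8 * E * e <= eps ^ 2).
    { apply Rle_trans with (8 * E * (eps ^ 2 / (8 * E))); [|apply Req_le; field; lra].
      apply Rmult_le_compat_l; [lra|apply Rmin_r]. }
    apply is_lim_seq_spec in Hlu. apply is_lim_seq_spec in Hlv.
    destruct (Hlu (mkposreal e He0)) as [N1 HN1]. destruct (Hlv (mkposreal e He0)) as [N2 HN2].
    simpl in HN1, HN2. exists (max N1 N2). intros k l Hk Hl r Hr.
    assert (Hkx := HN1 k ltac:(lia)). assert (Hlx := HN1 l ltac:(lia)).
    assert (Hky := HN2 k ltac:(lia)). assert (Hly := HN2 l ltac:(lia)).
    apply Rabs_def2 in Hkx, Hlx, Hky, Hly.
    assert (H1 : (x k r1 - x l r1) ^ 2 <= 4 * e).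
    { assert ((x k r1 - x l r1) ^ 2 <= (2 * e) ^ 2) by (apply pow_maj_Rabs, Rabs_le; lra). nra. }
    assert (H2 : (y k r1 - y l r1) ^ 2 <= 4 * e).
    { assert ((y k r1 - y l r1) ^ 2 <= (2 * e) ^ 2) by (apply pow_maj_Rabs, Rabs_le; lra). nra. }
    assert (H3 := Hdist (x k) (y k) (x l) (y l) (Hxs k) (Hxs l)
      (fun r Hr => HcC _ r Hr) (fun r Hr => HcC _ r Hr) r Hr).
    assert (H4 : E * ((x k r1 - x l r1) ^ 2 + (y k r1 - y l r1) ^ 2) <= E * (8 * e))
      by (apply Rmult_le_compat_l; lra).
    pose proof (pow2_ge_0 (x k r - x l r)). pose proof (pow2_ge_0 (y k r - y l r)).
    rewrite <- (Rabs_pos_eq eps) by lra.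
    split; apply Rsqr_le_abs_0; rewrite !Rsqr_pow2; lra. }
  set (us := fun r => real (Lim_seq (fun k => x k r))).
  set (vs := fun r => real (Lim_seq (fun k => y k r))).
  (* The interval must contain r1, where the data converge, and have r in its interior, where the
     limit is differentiated. *)
  assert (Hloc : forall r, 0 < r -> exists a b, 0 < a /\ a < r < b /\ a <= r1 <= b).
  { intros r Hr. exists (Rmin r r1 / 2), (Rmax r r1 + 1).
    assert (0 < Rmin r r1) by (apply Rmin_glb_lt; lra).
    pose proof (Rmin_l r r1). pose proof (Rmin_r r r1).
    pose proof (Rmax_l r r1). pose proof (Rmax_r r r1). lra. }
  assert (Hle : forall r m, 0 < r -> (exists J, forall j, (J <= j)%nat -> m <= u j r) -> m <= us r).
  { intros r m Hr [J HJ]. destruct (Hloc r Hr) as (a & b & Ha & Hab & Har).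
    destruct (uniform_limit_of_cauchy x (fun r => a <= r <= b)) as [Hlim _].
    { intros eps He. destruct (Hcau a b ltac:(lra) Har eps He) as [N HN].
      exists N. intros k l Hk Hl s Hs. apply HN; assumption. }
    apply (is_lim_seq_le_loc (fun _ => m) (fun k => x k r) m (us r)).
    - exists J. intros k Hk. apply HJ. specialize (Hidx k). lia.
    - apply is_lim_seq_const.
    - apply Hlim. lra. }
  exists us, vs. split; [|exact Hle].
  intros r Hr. destruct (Hloc r Hr) as (a & b & Ha & Hab & Har).
  destruct (uniform_limit_of_cauchy x (fun r => a <= r <= b)) as [Hlimx Hunx].
  { intros eps He. destruct (Hcau a b ltac:(lra) Har eps He) as [N HN].
    exists N. intros k l Hk Hl s Hs. apply HN; assumption. }
  destruct (uniform_limit_of_cauchy y (fun r => a <= r <= b)) as [Hlimy Huny].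
  { intros eps He. destruct (Hcau a b ltac:(lra) Har eps He) as [N HN].
    exists N. intros k l Hk Hl s Hs. apply HN; assumption. }
  fold us vs in Hlimx, Hunx, Hlimy, Huny.
  destruct (Hbd a b) as (c & C & Hc & HcC); [lra|].
  assert (HusB : forall s, a <= s <= b -> c <= us s <= C).
  { intros s Hs. split.
    - apply (is_lim_seq_le (fun _ => c) (fun k => x k s) c (us s));
        [intros k; apply HcC, Hs|apply is_lim_seq_const|apply Hlimx, Hs].
    - apply (is_lim_seq_le (fun k => x k s) (fun _ => C) (us s) C);
        [intros k; apply HcC, Hs|apply Hlimx, Hs|apply is_lim_seq_const]. }
  split; [|split].
  - apply (is_derive_uniform_limit x y us vs a b); trivial.
    + intros k s Hs. apply Hxs. lra.
    + intros k s Hs. destruct (Hxs k s) as (_ & Hd & _); [lra|].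
      eapply is_derive_continuous, Hd.
  - apply (is_derive_uniform_limit y (fun k => accel n p mu K f (x k) (y k)) vs
      (accel n p mu K f us vs) a b); trivial.
    + intros k s Hs. apply Hxs. lra.
    + destruct (accel_lipschitz n p mu K f a b c C) as (Lu & Lv & HLu & HLv & Hlip);
        try assumption; try lra.
      { specialize (HcC 0%nat r ltac:(lra)). lra. }
      intros eps He.
      set (e := eps / (Lu + Lv + 1)).
      assert (He0 : 0 < e) by (apply Rdiv_lt_0_compat; lra).
      destruct (Hunx e He0) as [N1 HN1]. destruct (Huny e He0) as [N2 HN2].
      exists (max N1 N2). intros k Hk s Hs. cbv beta.
      eapply Rle_trans; [apply Hlip; [exact Hs|apply HusB, Hs|apply HcC, Hs]|].
      specialize (HN1 k ltac:(lia) s Hs). specialize (HN2 k ltac:(lia) s Hs).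
      assert (Lu * Rabs (us s - x k s) <= Lu * e) by (apply Rmult_le_compat_l; assumption).
      assert (Lv * Rabs (vs s - y k s) <= Lv * e) by (apply Rmult_le_compat_l; assumption).
      assert (Hee : (Lu + Lv + 1) * e = eps) by (unfold e; field; lra).
      eapply Rle_trans; [apply Rplus_le_compat; eassumption|]. lra.
    + intros k s Hs. destruct (Hxs k s) as (Hdu & Hdv & Hpos); [lra|].
      apply continuous_accel; [lra|exact Hpos|apply HKc; lra|apply Hfc; lra| |].
      * eapply is_derive_continuous, Hdu.
      * eapply is_derive_continuous, Hdv.
  - specialize (HusB r ltac:(lra)). lra.
Qed.

(** Carries the lower bound at r0 to larger radii, where the Lyapunov argument says nothing. *)
Lemma superharmonic_weighted_nondecreasing (n : R) (u v w : R -> R) (a b : R) :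
  n > 2 -> superharmonic n u v w -> 0 < a <= b ->
  Rpower a (n - 2) * u a <= Rpower b (n - 2) * u b.
Proof.
  intros Hn H Hab.
  apply (nondecreasing_of_derive (fun r => Rpower r (n - 2) * u r)
    (fun r => Rpower r (n - 2) / r * (r * v r + (n - 2) * u r))); [lra| |].
  - intros x Hx. evar_last.
    { apply (is_derive_mult (fun r => Rpower r (n - 2)) u);
        [apply is_derive_Rpower; lra|apply H; lra|intros; apply Rmult_comm]. }
    unfold plus, mult; simpl. field. lra.
  - intros x Hx. apply Rmult_le_pos.
    + apply Rlt_le, Rdiv_lt_0_compat; [apply Rpower_pos|lra].
    + apply (superharmonic_scaled_derive_ge n u v w); trivial; lra.
Qed.

(** * Transfer to the original equation and conclusion *)

Lemma solves_E_radial_solution (N : nat) (p mu : R) (K f u : R -> R) :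
  solves_E N p mu K f u -> radial_solution (INR N) p mu K f u (Derive u).
Proof.
  intros (u1 & u2 & H) r Hr. destruct (H r Hr) as (Hu & Hu1 & _ & Hpos & Heq).
  assert (Hv : Derive u r = u1 r) by (apply is_derive_unique; exact Hu).
  split; [rewrite Hv; exact Hu|]. split; [|exact Hpos].
  replace (accel (INR N) p mu K f u (Derive u) r) with (u2 r) by (unfold accel; rewrite Hv; lra).
  apply (is_derive_ext_loc u1); [|exact Hu1].
  (* The ball of radius r about r stays in (0, oo), where [Derive u] and u1 agree. *)
  exists (mkposreal r Hr). intros t Ht. change (Rabs (t - r) < r) in Ht.
  apply Rabs_def2 in Ht. destruct (H t) as (Hut & _); [lra|].
  symmetry. apply is_derive_unique. exact Hut.
Qed.

Lemma radial_solution_solves_E (N : nat) (p mu : R) (K f u v : R -> R) :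
  (forall r, 0 < r -> continuous K r) -> (forall r, 0 < r -> continuous f r) ->
  radial_solution (INR N) p mu K f u v -> solves_E N p mu K f u.
Proof.
  intros HK Hf H. exists v, (accel (INR N) p mu K f u v).
  intros r Hr. destruct (H r Hr) as (Hu & Hv & Hpos).
  split; [exact Hu|]. split; [exact Hv|]. split; [|split; [exact Hpos|unfold accel; ring]].
  apply continuous_accel; auto; eapply is_derive_continuous; eassumption.
Qed.

Lemma nonincreasing_sup_at_0 (u : R -> R) (L : R) :
  (forall a b, 0 < a <= b -> u b <= u a) ->
  filterlim u (at_right 0) (locally L) -> sup_at_0 u L.
Proof.
  intros Hdec Hlim.
  assert (Hnear : forall d eps, 0 < d -> 0 < eps ->
    exists s, 0 < s <= d /\ Rabs (u s - L) < eps).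
  { intros d eps Hd He.
    apply (filterlim_locally (F := at_right 0) u L) with (eps := mkposreal eps He) in Hlim.
    destruct Hlim as [e Hball]. pose proof (cond_pos e).
    assert (0 < Rmin d (e / 2)) by (apply Rmin_glb_lt; lra).
    pose proof (Rmin_r d (e / 2)).
    exists (Rmin d (e / 2)). split; [split; [lra|apply Rmin_l]|].
    apply (Hball (Rmin d (e / 2))); [|lra].
    change (Rabs (Rmin d (e / 2) - 0) < e). rewrite Rminus_0_r, Rabs_pos_eq; lra. }
  split.
  - intros r Hr. apply le_epsilon; intros eps He.
    destruct (Hnear r eps Hr He) as (s & Hs & Hus). apply Rabs_def2 in Hus.
    specialize (Hdec s r Hs). lra.
  - intros d eps Hd He. destruct (Hnear d eps Hd He) as (s & Hs & Hus).
    apply Rabs_def2 in Hus. exists s. split; [exact Hs|lra].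
Qed.

Theorem theorem1p2 (N : nat) (p mu alpha k0 nu : R) (K f : R -> R)
  (u : nat -> R -> R) :
  (3 <= N)%nat -> p > 1 -> mu >= 0 ->
  K0_hyp K alpha k0 -> F0_hyp f nu ->
  p > p_S N alpha ->
  (forall j, bounded_solution N p mu K f (u j)) ->
  (* ||u_j||_{L^oo(0,oo)} -> oo *)
  (forall M : R, exists J : nat, forall j, (J <= j)%nat ->
      exists r, 0 < r /\ M < Rabs (u j r)) ->
  exists ustar : R -> R, singular_solution N p mu K f ustar.
Proof.
  intros HN Hp Hmu HK HF HpS Hbdd Hinf.
  set (n := INR N).
  assert (Hn : n > 2).
  { apply (le_INR 3 N) in HN. simpl in HN. unfold n. lra. }
  assert (HK' := HK). destruct HK' as (HKc & HKpos & Hal & _ & _).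
  assert (HF' := HF). destruct HF' as (Hfc & Hfpos & _ & _ & _).
  set (theta := (2 + alpha) / (p - 1)).
  assert (Hth : theta * (p - 1) = 2 + alpha) by (unfold theta; field; lra).
  assert (Hth0 : 0 < theta) by (apply Rdiv_lt_0_compat; lra).
  assert (Ha : 0 < n - 2 - 2 * theta).
  { apply (Rmult_lt_compat_r (n - 2)) in HpS; [|lra].
    unfold p_S in HpS. fold n in HpS.
    replace ((n + 2 + 2 * alpha) / (n - 2) * (n - 2)) with (n + 2 + 2 * alpha) in HpS
      by (field; lra).
    apply (Rmult_lt_reg_r (p - 1)); [lra|]. nra. }
  destruct (uniform_bounds_near_0 n p mu alpha nu k0 theta K f Hn Hp Hmu HK HF Hth Ha)
    as (r0 & m & C & d & L0 & Hr0 & Hm & HC & Hd & Hunif).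
  assert (Hsol : forall j, radial_solution n p mu K f (u j) (Derive (u j))).
  { intros j. apply solves_E_radial_solution, Hbdd. }
  assert (Hsh := fun j => radial_superharmonic n p mu K f (u j) (Derive (u j))
                            Hmu HKpos Hfpos (Hsol j)).
  assert (Hlow : forall rho, 0 < rho -> exists J, forall j, (J <= j)%nat ->
    (forall r, 0 < r <= r0 -> Rpower r theta * u j r <= C) /\
    (forall r, rho <= r <= r0 -> m <= Rpower r theta * u j r)).
  { intros rho Hrho.
    (* L >= (d / rho)^theta is equivalent to d L^(-1/theta) <= rho, which puts [rho, r0] inside the
       range of the uniform lower bound. *)
    destruct (Hinf (Rmax L0 (Rpower (d / rho) theta))) as [J HJ]. exists J. intros j Hj.
    destruct (HJ j Hj) as (r & Hr & HM). destruct (Hbdd j) as [_ [L HL]].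
    apply nonincreasing_sup_at_0 in HL.
    2: { intros a b Hab. eapply superharmonic_nonincreasing; [exact Hn|apply Hsh|exact Hab]. }
    destruct (Hsol j r Hr) as (_ & _ & Hpos). rewrite Rabs_pos_eq in HM by lra.
    pose proof (proj1 HL r Hr) as HrL.
    pose proof (Rmax_l L0 (Rpower (d / rho) theta)).
    pose proof (Rmax_r L0 (Rpower (d / rho) theta)).
    destruct (Hunif (u j) (Derive (u j)) L (Hsol j) HL) as [Hup Hlo]; [lra|].
    split; [exact Hup|]. intros s Hs. apply Hlo. split; [|lra].
    apply Rle_trans with rho; [|lra].
    assert (Hdr : 0 < d / rho) by (apply Rdiv_lt_0_compat; lra).
    assert (HLd : d / rho <= Rpower L (/ theta)).
    { apply Rle_trans with (Rpower (Rpower (d / rho) theta) (/ theta)).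
      - rewrite Rpower_mult, Rinv_r, Rpower_1; lra.
      - apply Rle_Rpower_l; [apply Rlt_le, Rinv_0_lt_compat; lra|].
        split; [apply Rpower_pos|lra]. }
    rewrite Rpower_Ropp. pose proof (Rpower_pos L (/ theta)).
    apply (Rmult_le_reg_r (Rpower L (/ theta))); [assumption|].
    rewrite Rmult_assoc, Rinv_l, Rmult_1_r by lra.
    apply (Rmult_le_compat_l rho) in HLd; [|lra].
    replace (rho * (d / rho)) with d in HLd by (field; lra). exact HLd. }
  (* rho = r0 fixes one tail of the sequence with the upper bound on (0, r0] and the lower bound at
     r0; compactness needs no more. *)
  destruct (Hlow r0 Hr0) as [J0 HJ0].
  assert (Hr0t := Rpower_pos r0 theta).
  destruct (radial_compactness n p mu K f (fun j => u (J0 + j)%nat)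
    (fun j => Derive (u (J0 + j)%nat)) r0 ((n - 2) * (C / Rpower r0 theta) / r0))
    as (us & vs & Hus & Hge); trivial.
  { intros a b Hab.
    (* By monotonicity u on [a, b] lies between its values at b' and a'. The value at a' <= r0 is
       bounded by C, and the value at b' >= r0 is bounded below through the growth of r^(n-2) u. *)
    set (a' := Rmin a r0). set (b' := Rmax b r0).
    assert (Ha' : 0 < a') by (apply Rmin_glb_lt; lra).
    assert (Haa : a' <= a) by apply Rmin_l. assert (Har : a' <= r0) by apply Rmin_r.
    assert (Hbb : b <= b') by apply Rmax_l. assert (Hbr : r0 <= b') by apply Rmax_r.
    pose proof (Rpower_pos r0 (n - 2)). pose proof (Rpower_pos b' (n - 2)).
    pose proof (Rpower_pos a' theta).
    exists (Rpower r0 (n - 2) * (m / Rpower r0 theta) / Rpower b' (n - 2)), (C / Rpower a' theta).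
    split.
    { apply Rdiv_lt_0_compat; [|assumption]. apply Rmult_lt_0_compat; [assumption|].
      apply Rdiv_lt_0_compat; assumption. }
    intros j r Hr. destruct (HJ0 (J0 + j)%nat ltac:(lia)) as [Hup Hlo]. split.
    - apply Rle_trans with (u (J0 + j)%nat b').
      + apply Rle_div_l; [assumption|].
        rewrite (Rmult_comm (u _ _)).
        eapply Rle_trans;
          [|apply (superharmonic_weighted_nondecreasing n _ _ _ r0 b' Hn (Hsh (J0 + j)%nat)); lra].
        apply Rmult_le_compat_l; [lra|].
        apply Rle_div_l; [assumption|].
        rewrite Rmult_comm. apply Hlo; lra.
      + eapply superharmonic_nonincreasing; [exact Hn|apply Hsh|lra].
    - apply Rle_trans with (u (J0 + j)%nat a').
      + eapply superharmonic_nonincreasing; [exact Hn|apply Hsh|lra].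
      + apply (Rle_div_r _ C); [assumption|].
        rewrite Rmult_comm. apply Hup; lra. }
  (* The slope at r0 is controlled by the value, since - (n-2) u <= r u' <= 0. *)
  { intros j. destruct (HJ0 (J0 + j)%nat ltac:(lia)) as [Hup _].
    assert (Hh := superharmonic_scaled_derive_ge n _ _ _ r0 Hn (Hsh (J0 + j)%nat) Hr0).
    assert (Hv := superharmonic_derive_nonpos n _ _ _ r0 Hn (Hsh (J0 + j)%nat) Hr0).
    assert (Hu : u (J0 + j)%nat r0 <= C / Rpower r0 theta).
    { apply (Rle_div_r _ C); [assumption|]. rewrite Rmult_comm. apply Hup; lra. }
    rewrite Rabs_left1 by exact Hv.
    apply (Rle_div_r _ ((n - 2) * (C / Rpower r0 theta))); [lra|].
    assert ((n - 2) * u (J0 + j)%nat r0 <= (n - 2) * (C / Rpower r0 theta))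
      by (apply Rmult_le_compat_l; lra).
    lra. }
  exists us. split; [exact (radial_solution_solves_E N p mu K f us vs HKc Hfc Hus)|].
  intros P [M HM].
  destruct (Rpower_small theta (m / (Rabs M + 1))) as (e & He & Hsmall); [exact Hth0| |].
  { apply Rdiv_lt_0_compat; [exact Hm|]. pose proof (Rabs_pos M). lra. }
  assert (Hmin : 0 < Rmin e r0) by (apply Rmin_glb_lt; lra).
  exists (mkposreal _ Hmin). intros r Hball Hr.
  change (Rabs (r - 0) < Rmin e r0) in Hball.
  rewrite Rminus_0_r, Rabs_pos_eq in Hball by lra.
  pose proof (Rmin_l e r0). pose proof (Rmin_r e r0).
  apply HM.
  assert (Hur : m / Rpower r theta <= us r).
  (* Here [Hlow] is taken with rho = r. The resulting us >= m r^(-theta) holds on all of (0, r0]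
     although J depends on r. *)
  { apply Hge; [exact Hr|]. destruct (Hlow r Hr) as [J HJ]. exists J. intros j Hj.
    apply Rle_div_l; [apply Rpower_pos|].
    rewrite Rmult_comm. apply (HJ (J0 + j)%nat ltac:(lia)). lra. }
  apply Rlt_le_trans with (2 := Hur).
  specialize (Hsmall r ltac:(lra)). pose proof (Rpower_pos r theta) as Hrt.
  pose proof (Rle_abs M). pose proof (Rabs_pos M).
  apply Rlt_le_trans with (Rabs M + 1); [lra|].
  apply (Rle_div_r _ m); [exact Hrt|].
  apply (Rmult_le_compat_l (Rabs M + 1)) in Hsmall; [|lra].
  replace ((Rabs M + 1) * (m / (Rabs M + 1))) with m in Hsmall by (field; lra). exact Hsmall.
Qed.
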